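(* In the $K$-tier network model described in the context with $W=0$ and target $\beta>0$, let $\mathcal O_k^{int}=\mathbb P\{P_k\|\mathbf h\|^2X_k^{-\alpha_k}/I_o<\beta\}$ and $\phi_k=(M_k!)^{-1/M_k}$. For $b\ge0$ let $\varphi_{j,k}(0;b)=\frac{\delta_j t\,{}_2F_1(1,1-\delta_j;2-\delta_j;-t)}{1-\delta_j}$ with $t=b/(M_{j,k}B_{j,k})$. For $S\in\{L,U\}$ and $m\in\{0,\dots,M_k\}$ put $b^L_m=m\phi_k\beta$, $b^U_m=m\beta$, and $$\mathcal O_k^{int,S}=\frac{\pi\lambda_k}{\mathcal T_k}\sum_{m=0}^{M_k}\binom{M_k}{m}(-1)^m\int_0^{R_k^2}\exp\Big(-\pi\sum_{j=1}^K\lambda_j\Omega_{j,k}^{\delta_j}\big(1+\mathcal A_j\varphi_{j,k}(0;b^S_m)\big)x^{\delta_{j,k}}\Big)dx.$$ Then $\mathcal O_k^{int,L}\le\mathcal O_k^{int}\le\mathcal O_k^{int,U}$. Moreover, if $\alpha_j=\alpha$ for all $j$, then with $\Lambda=\sum_j\lambda_j\Omega_j^\delta$ and $\mathcal Z^S_{k,m}=\Lambda/\Omega_k^\delta+\sum_j\mathcal A_j\lambda_j\Omega_{j,k}^{\delta}\varphi_{j,k}(0;b^S_m)$, $$\mathcal O_k^{int,S}=\frac{\lambda_k}{\mathcal T_k}\sum_{m=0}^{M_k}\binom{M_k}{m}\frac{(-1)^m}{\mathcal Z^S_{k,m}}\Big(1-e^{-\pi\mathcal Z^S_{k,m}R_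k^2}\Big).$$
   Context: Network model: $\mathcal K=\{1,\dots,K\}$. In $\mathbb R^2$, tier-$k$ BSs form a homogeneous PPP of intensity $\lambda_k>0$ and users a homogeneous PPP of intensity $\lambda_u>0$, all independent. Tier-$k$ BSs have transmit power $P_k>0$, $M_k\in\mathbb N$ antennas, bias $B_k>0$, path-loss exponent $\alpha_k>2$. $\Omega_k=P_kM_kB_k$, $\delta_k=2/\alpha_k$, $\mathcal V_{j,k}=\mathcal V_j/\mathcal V_k$ for $\mathcal V\in\{P,M,B,\Omega,\delta\}$. Access threshold $\epsilon>0$, $R_k=(\Omega_k/\epsilon)^{1/\alpha_k}$. Association: with $D_k$ the distance from a typical user to its nearest tier-$k$ BS, $\hat\rho_k=\Omega_kD_k^{-\alpha_k}$ if $D_k\le R_k$, else $0$; the user is associated with tier $k$ iff $\hat\rho_k>\hat\rho_j$ for all $j\ne k$, with probability $\mathcal T_k=\pi\lambda_k\int_0^{R_k^2}\exp(-\pi\sum_j\lambda_j\Omega_{j,k}^{\delta_j}r^{\delta_{j,k}})dr$. Activation probability of tier $j$: $\mathcal A_j=1-\exp\big(-\pi\lambda_u\int_0^{R_j^2}\exp(-\pi\sum_l\lambda_l\Omega_{l,j}^{\delta_l}r^{\delta_{l,j}})dr\big)$; active tier-$j$ BSs are modeled as a homogeneous PPP of intensity $\mathcal A_j\lambda_j$. SINR model: conditional on association with tier $k$, the serving distance $X_k$ has density $\frac{2\pi\lambda_k}{\mathcal T_k}x\exp(-\pi\sum_j\lambda_j\Omega_{j,k}^{\delta_j}x^{2\delta_{j,k}})$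 on $(0,R_k]$; given $X_k$, interferers of tier $j$ are the points of independent homogeneous PPPs of intensity $\mathcal A_j\lambda_j$ outside the disk around the user of radius $\Omega_{j,k}^{1/\alpha_j}X_k^{\alpha_k/\alpha_j}$; the signal gain $\|\mathbf h\|^2\sim\mathrm{Gamma}(M_k,1)$, an interferer of tier $j$ at distance $r$ contributes $P_jVr^{-\alpha_j}$ with $V\sim\mathrm{Exp}(1)$, all fading independent of each other and of the point processes; $I_o$ is the total interference. ${}_2F_1$ is the Gauss hypergeometric function. *)

(* Defs.v *)
From HB Require Import structures.
From mathcomp Require Import all_boot all_order all_algebra.
From mathcomp Require Import all_classical all_reals all_analysis.
From mathcomp Require Import measurable_realfun.
Set Implicit Arguments. Unset Strict Implicit. Unset Printing Implicit Defensive.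
Import Order.TTheory GRing.Theory Num.Theory.
Import numFieldNormedType.Exports.
Local Open Scope classical_set_scope.
Local Open Scope ring_scope.

Section Model.
Variable R : realType.
Local Notation leb := (@lebesgue_measure R).

(* A marked point: ((location in R^2), fading mark V). *)
Definition pt := ((R * R) * R)%type.
Definition norm2 (y : R * R) : R := Num.sqrt (y.1 ^+ 2 + y.2 ^+ 2).

Definition cnt (S A : set pt) : \bar R := (\esum_(p in S `&` A) 1)%E.

(* Poisson probability mass function, mean r >= 0 (Poisson(0) = Dirac at 0). *)
Definition poisson_mass (r : R) (n : nat) : R := r ^+ n / (n`!)%:R * expR (- r).

(* Intensity measure of a homogeneous PPP of density c in R^2 marked by
   i.i.d. Exp(1) marks: c * Leb_2 (x) Exp(1). *)
Definition mpp_intensity (c : R) (A : set pt) : \bar R :=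
  (c%:E * \int[leb]_y1 \int[leb]_y2 \int[leb]_(v in `[0%R, +oo[)
       ((\1_A ((y1, y2), v) : R) * expR (- v))%:E)%E.

Definition gamma_pdf (M : nat) (x : R) : R :=
  x ^+ M.-1 * expR (- x) / (M.-1)`!%:R.

(* Gauss hypergeometric function 2F1(a,b;c;z), via Euler's integral
   representation (valid for c > b > 0 and z < 1, which covers all uses). *)
Definition hyp2F1 (a b c z : R) : R :=
  (\int[leb]_(s in `[0, 1]) (powR s (b - 1) * powR (1 - s) (c - b - 1)
                              * powR (1 - z * s) (- a)))
  / (\int[leb]_(s in `[0, 1]) (powR s (b - 1) * powR (1 - s) (c - b - 1))).

Section Net.
Variables (K : nat) (lam Pw B alpha : 'I_K -> R) (M : 'I_K -> nat)
          (lam_u eps : R).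

Definition Omega (j : 'I_K) : R := Pw j * (M j)%:R * B j.
Definition delta (j : 'I_K) : R := 2 / alpha j.
Definition Rk (j : 'I_K) : R := powR (Omega j / eps) (1 / alpha j).

Definition expo_sum (k : 'I_K) (r : R) : R :=
  \sum_(j < K) lam j * powR (Omega j / Omega k) (delta j)
                * powR r (delta j / delta k).

Definition Tassoc (k : 'I_K) : R :=
  pi * lam k * \int[leb]_(r in `[0, Rk k ^+ 2]) expR (- (pi * expo_sum k r)).

Definition Aact (j : 'I_K) : R :=
  1 - expR (- (pi * lam_u *
     \int[leb]_(r in `[0, Rk j ^+ 2]) expR (- (pi * expo_sum j r)))).

(* density of the serving distance X_k on (0, R_k] *)
Definition fX (k : 'I_K) (x : R) : R :=
  2 * pi * lam k / Tassoc k * x *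
  expR (- (pi * \sum_(j < K) lam j * powR (Omega j / Omega k) (delta j)
                       * powR x (2 * (delta j / delta k)))).

(* exclusion radius for tier-j interferers when the serving distance is x *)
Definition excl_radius (k j : 'I_K) (x : R) : R :=
  powR (Omega j / Omega k) (1 / alpha j) * powR x (alpha k / alpha j).

(* total interference at the typical user, given serving distance x:
   Phi j w is the (marked) point configuration of active tier-j BSs. *)
Definition interference {Om : Type} (Phi : 'I_K -> Om -> set pt)
    (k : 'I_K) (x : R) (w : Om) : \bar R :=
  (\sum_(j < K) \esum_(p in Phi j w `&` [set p : pt | (excl_radius k j x < norm2 p.1)%R])
      (Pw j * p.2 * powR (norm2 p.1) (- alpha j))%:E)%E.

Definition Oint {d : measure_display} {Om : measurableType d}
    (Pr : probability Om R) (G : Om -> R) (Phi : 'I_K -> Om -> set pt)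
    (k : 'I_K) (beta : R) : R :=
  \int[leb]_(x in `]0, Rk k]) (fX k x *
     fine (Pr [set w | (Pw k * G w * powR x (- alpha k))%:E
                         < (beta%:E * interference Phi k x w)%E]%E)).

Definition varphi (j k : 'I_K) (b : R) : R :=
  let t := b / (((M j)%:R / (M k)%:R) * (B j / B k)) in
  delta j * t * hyp2F1 1 (1 - delta j) (2 - delta j) (- t) / (1 - delta j).

Definition phik (k : 'I_K) : R := powR ((M k)`!%:R) (- 1 / (M k)%:R).

Definition bL (k : 'I_K) (beta : R) (m : nat) : R := m%:R * phik k * beta.
Definition bU (beta : R) (m : nat) : R := m%:R * beta.

Definition Obound (k : 'I_K) (b : nat -> R) : R :=
  pi * lam k / Tassoc k *
  \sum_(m < (M k).+1) 'C(M k, m)%:R * (-1) ^+ m *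
     \int[leb]_(x in `[0, Rk k ^+ 2])
        expR (- (pi * \sum_(j < K) lam j * powR (Omega j / Omega k) (delta j)
                   * (1 + Aact j * varphi j k (b m)) * powR x (delta j / delta k))).

Definition Zcoef (a : R) (k : 'I_K) (b : nat -> R) (m : nat) : R :=
  (\sum_(j < K) lam j * powR (Omega j) (2 / a)) / powR (Omega k) (2 / a)
  + \sum_(j < K) Aact j * lam j * powR (Omega j / Omega k) (2 / a) * varphi j k (b m).

Definition Oclosed (a : R) (k : 'I_K) (b : nat -> R) : R :=
  lam k / Tassoc k *
  \sum_(m < (M k).+1) 'C(M k, m)%:R * (-1) ^+ m / Zcoef a k b m
     * (1 - expR (- (pi * Zcoef a k b m * Rk k ^+ 2))).

End Net.
End Model.

(* Main.v *)
(** Fix the serving distance [x].  After rescaling, outage is the event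
    [G < sum_j sum_(p in Phi_j) f_j p] for explicit nonnegative functions [f_j].
    Approximating the [f_j] from below by simple functions turns the right-hand
    side into a finite combination of independent Poisson counts, and conditioning
    on these counts one at a time shows that any bound of the form
    [sum_m w_m exp (- th_m y)] on the distribution function of [G] turns into the
    bound [sum_m w_m prod_j exp (- int (1 - exp (- th_m f_j)))] on the outage
    probability; only the monotone limit of the approximation is then needed.
    Alzer's inequality
    [(1 - exp (- phi y))^M <= P (G <= y) <= (1 - exp (- y))^M] provides such bounds
    by the binomial theorem.  The exponents are computed by integrating out the
    marks, passing to polar coordinates through the area of the disk, and
    substituting [w = r^2 s^(- delta)], which produces Euler's integral for 2F1.
    Finally the bounds are averaged over [x], with the substitution [y = x^2]. *)
Require Import Defs.
From HB Require Import structures.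
From mathcomp Require Import all_boot all_order all_algebra.
From mathcomp Require Import all_classical all_reals all_analysis.
From mathcomp Require Import measurable_realfun.
From mathcomp Require Import ring.
Import Order.TTheory GRing.Theory Num.Theory.
Import numFieldNormedType.Exports.
Local Open Scope classical_set_scope.
Local Open Scope ring_scope.
Set Implicit Arguments. Unset Strict Implicit. Unset Printing Implicit Defensive.

(** * Compound Poisson sums *)

(** The weights [w_m] alternate in sign, so a bound on the distribution function cannot be
    transported to the outage probability term by term. The bound is used as a whole, at every
    nonnegative value of the weighted sum of counts, and then averaged against Poisson masses, which
    are nonnegative; only the averaged expression factorizes into Laplace transforms.

    Independence is given through counts on disjoint sets of finite intensity, whereas the region
    outside an exclusion disk has infinite intensity. This is why simple functions enter through
    their level sets at nonzero values: the finite Laplace exponent bounds the intensity of each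
    such set. The interference is a sum in [\bar R] that is not known to be finite; since outage is
    a strict inequality, the approximating events still increase to it.

    Both sides of Alzer's inequality concern a difference that vanishes at zero and at infinity and
    whose derivative can change sign only from plus to minus. In the final averaging, integrals are
    compared as suprema over simple functions, so no regularity of the outage probability in [x]
    enters. *)

Lemma poisson_mass_ge0 (R : realType) (r : R) (n : nat) :
  0 <= r -> 0 <= poisson_mass r n.
Proof. by move=> r0; rewrite /poisson_mass !mulr_ge0// ?exprn_ge0// expR_ge0. Qed.

(** After scaling by [expR (- r)], this is the exponential series at [r * expR (- t)]; [t = 0] gives
    the total mass. *)
Lemma poisson_laplace (R : realType) (r t : R) :
  series (fun q => expR (- (t * q%:R)) * poisson_mass r q) @ \oo -->
  expR (- (r * (1 - expR (- t)))).
Proof.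
have -> : (fun q => expR (- (t * q%:R)) * poisson_mass r q) =
          expR (- r) *: exp_coeff (r * expR (- t)).
  apply/funext => q; rewrite /poisson_mass /exp_coeff /= fctE.
  rewrite -mulNr mulrC expRM_natr exprMn /GRing.scale /=.
  by ring.
have -> : expR (- (r * (1 - expR (- t)))) =
          limn (series (expR (- r) *: exp_coeff (r * expR (- t)))).
  rewrite lim_seriesZ; last exact: is_cvg_series_exp_coeff.
  rewrite -/(expR _) /GRing.scale /= -expRD; congr expR; ring.
exact/is_cvg_seriesZ/is_cvg_series_exp_coeff.
Qed.

Lemma poisson_mass_total (R : realType) (r : R) :
  series (poisson_mass r) @ \oo --> (1 : R).
Proof.
have := @poisson_laplace R r 0; rewrite oppr0 expR0 subrr mulr0 oppr0 expR0.
by under eq_fun do rewrite mul0r oppr0 expR0 mul1r.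
Qed.

Lemma cvg_sumr (R : numFieldType) (T I : Type) (F : set_system T) {FF : Filter F}
    (s : seq I) (f : I -> T -> R) (l : I -> R) :
  (forall i, f i x @[x --> F] --> l i) ->
  (\sum_(i <- s) f i x) @[x --> F] --> \sum_(i <- s) l i.
Proof.
move=> fl; elim: s => [|i s IH].
  by under eq_fun do rewrite big_nil; rewrite big_nil; exact: cvg_cst.
under eq_fun do rewrite big_cons.
by rewrite big_cons; apply: cvgD.
Qed.

Section compound_poisson.
Context (R : realType) (d : measure_display) (Om : measurableType d).
Variables (Pr : probability Om R) (G : Om -> R) (F : R -> R).
Hypothesis mG : measurable_fun setT G.
Hypothesis cdfG : forall t, Pr [set w | G w <= t] = (F t)%:E.
Hypothesis contF : continuous F.

Lemma measurable_lt_EFin (Y : Om -> \bar R) : measurable_fun setT Y ->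
  measurable [set w | ((G w)%:E < Y w)%E].
Proof.
move=> mY; have := @measurable_lte _ _ R setT measurableT (EFin \o G) Y.
by rewrite setTI; apply => //; exact/measurable_EFinP.
Qed.

Lemma measurable_le_cst t : measurable [set w | G w <= t].
Proof.
rewrite (_ : [set w | G w <= t] = G @^-1` `]-oo, t]).
  by rewrite -[X in measurable X]setTI; exact: mG.
by apply/seteqP; split => w /=; rewrite in_itv.
Qed.

(** Outage is a strict inequality while the laws are given for [G w <= t]. The strict event is the
    increasing union over [y - 1 / (n + 1)], and continuity of [F] makes the left limit equal to
    [F y]. *)
Lemma independent_lt (B : set Om) (p : R) : measurable B ->
  (forall t, Pr ([set w | G w <= t] `&` B) = (F t * p)%:E) ->
  forall y, Pr ([set w | G w < y] `&` B) = (F y * p)%:E.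
Proof.
move=> mB H y.
pose E n := [set w | G w <= y - n.+1%:R^-1] `&` B.
have mE n : measurable (E n) by apply: measurableI => //; exact: measurable_le_cst.
have UE : [set w | G w < y] `&` B = \bigcup_n E n.
  apply/seteqP; split => [w /= [Gy Bw]|w [n _ [/= Gy Bw]]]; last first.
    by split => //; apply: le_lt_trans Gy _; rewrite gtrBl invr_gt0.
  have y0 : 0 < y - G w by rewrite subr_gt0.
  exists (Num.truncn (y - G w)^-1) => //; split => //=.
  rewrite lerBrDl -lerBrDr -[leRHS]invrK lef_pV2 ?posrE ?invr_gt0//.
  by apply/ltW; rewrite truncnS_gt ?invr_ge0// ltW.
have cE : Pr (E n) @[n --> \oo] --> Pr (\bigcup_n E n).
  apply: nondecreasing_cvg_mu => //; first exact: bigcupT_measurable.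
  move=> n m nm; apply/subsetPset => w [/= h1 h2]; split => //=.
  apply: le_trans h1 _; rewrite lerD2l lerN2 lef_pV2 ?posrE//.
  by rewrite ler_nat.
rewrite UE; apply: (cvg_unique _ cE) => //.
rewrite /=; under eq_fun do rewrite /E H.
apply: cvg_EFin; first exact: nearW.
apply: (@cvgM _ _ _ _ _ _ (F y) p); last exact: cvg_cst.
apply: continuous_cvg; first exact: contF.
rewrite -[X in _ --> X]subr0; apply: cvgB; first exact: cvg_cst.
exact: cvg_harmonic.
Qed.

Lemma cdf_cvg1 : F n%:R @[n --> \oo] --> (1 : R).
Proof.
have cE : Pr [set w | G w <= n%:R] @[n --> \oo] --> Pr (\bigcup_n [set w | G w <= n%:R]).
  apply: nondecreasing_cvg_mu.
  - by move=> n; exact: measurable_le_cst.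
  - by apply: bigcupT_measurable => n; exact: measurable_le_cst.
  move=> n m nm; apply/subsetPset => w /= h.
  by apply: le_trans h _; rewrite ler_nat.
move: cE; rewrite (_ : \bigcup_n _ = setT); last first.
  apply/seteqP; split => // w _; exists (Num.truncn `|G w|).+1 => //=.
  by apply: le_trans (ler_norm _) _; apply/ltW/truncnS_gt.
rewrite probability_setT; under eq_fun do rewrite cdfG.
by move/fine_cvg.
Qed.

(** Letting [t] tend to infinity removes [G] and recovers the marginal probability from the joint
    one. *)
Lemma independent_total (B : set Om) (p : R) : measurable B ->
  (forall t, Pr ([set w | G w <= t] `&` B) = (F t * p)%:E) -> Pr B = p%:E.
Proof.
move=> mB H.
have cE : Pr ([set w | G w <= n%:R] `&` B) @[n --> \oo] -->
    Pr (\bigcup_n ([set w | G w <= n%:R] `&` B)).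
  have m n : measurable ([set w | G w <= n%:R] `&` B).
    by apply: measurableI => //; exact: measurable_le_cst.
  apply: nondecreasing_cvg_mu => //; first exact: bigcupT_measurable.
  move=> n m' nm; apply/subsetPset => w /= [h ?]; split => //.
  by apply: le_trans h _; rewrite ler_nat.
move: cE; rewrite -setI_bigcupl (_ : \bigcup_n _ = setT); last first.
  apply/seteqP; split => // w _; exists (Num.truncn `|G w|).+1 => //=.
  by apply: le_trans (ler_norm _) _; apply/ltW/truncnS_gt.
rewrite setTI => cE; apply: (cvg_unique _ cE) => //.
rewrite /=; under eq_fun do rewrite H.
apply: cvg_EFin; first exact: nearW.
rewrite -[X in _ --> X]mul1r; apply: (@cvgM _ _ _ _ _ _ 1 p); last exact: cvg_cst.
exact: cdf_cvg1.
Qed.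

Variables (n : nat) (N : nat -> Om -> \bar R) (r a : nat -> R).
Hypothesis mN : forall i, measurable_fun setT (N i).
Hypothesis r_ge0 : forall i, 0 <= r i.
Hypothesis a_ge0 : forall i, 0 <= a i.
Hypothesis N_nat : forall i, (i < n)%N ->
  Pr (\bigcup_q [set w | N i w = q%:R%:E]) = 1%E.
Hypothesis indepN : forall (c : nat -> nat) t,
  Pr ([set w | G w <= t] `&` [set w | forall i, (i < n)%N -> N i w = (c i)%:R%:E])
  = (F t * \prod_(0 <= i < n) poisson_mass (r i) (c i))%:E.

Variables (m : nat) (wt thL thU : nat -> R).
Hypothesis FL : forall y, 0 <= y -> \sum_(i < m) wt i * expR (- (thL i * y)) <= F y.
Hypothesis FU : forall y, 0 <= y -> F y <= \sum_(i < m) wt i * expR (- (thU i * y)).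

(** The bound once the first [l] counts have been averaged out: each contributes its Poisson Laplace
    transform, and the shift [y] absorbs the contribution of counts frozen at a value. *)
Let Psi (th : nat -> R) (l : nat) (y : R) : R :=
  \sum_(i < m) wt i * expR (- (th i * y)) *
     \prod_(0 <= j < l) expR (- (r j * (1 - expR (- (th i * a j))))).

Let Ev l y (c : nat -> nat) :=
  [set w | ((G w)%:E < y%:E + \sum_(0 <= i < l) (a i)%:E * N i w)%E] `&`
  [set w | forall i, (l <= i < n)%N -> N i w = (c i)%:R%:E].

Let measurable_fix l (c : nat -> nat) :
  measurable [set w | forall i, (l <= i < n)%N -> N i w = (c i)%:R%:E].
Proof.
rewrite (_ : [set w | _] = \bigcap_(i in [set i | (l <= i < n)%N])
   (N i @^-1` [set (c i)%:R%:E])).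
  apply: bigcap_measurableType => i _.
  by rewrite -[X in measurable X]setTI; apply: mN => //; exact: emeasurable_set1.
by apply/seteqP; split => w /= h i; exact: h.
Qed.

Let measurable_Ev l y c : measurable (Ev l y c).
Proof.
apply: measurableI; last exact: measurable_fix.
apply: measurable_lt_EFin; apply: emeasurable_funD; first exact: measurable_cst.
by apply: emeasurable_sum => i; apply: measurable_funeM; exact: mN.
Qed.

(** The exponential of [y + a l * q] splits, so averaging over [q] multiplies the term of index [i]
    by the Laplace transform of count [l] at [th i * a l]. *)
Let Psi_step th l y :
  series (fun q => Psi th l (y + a l * q%:R) * poisson_mass (r l) q) @ \oo -->
  Psi th l.+1 y.
Proof.
have -> : (fun q => Psi th l (y + a l * q%:R) * poisson_mass (r l) q) =
  \sum_(i < m) ((wt i * expR (- (th i * y)) *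
     \prod_(0 <= j < l) expR (- (r j * (1 - expR (- (th i * a j)))))) *:
     (fun q : nat => expR (- ((th i * a l) * q%:R)) * poisson_mass (r l) q)).
  apply/funext => q; rewrite fct_sumE /Psi mulr_suml; apply: eq_bigr => i _.
  rewrite fctE /GRing.scale /= mulrDr opprD expRD !mulrA; ring.
have -> : Psi th l.+1 y = \sum_(i < m) ((wt i * expR (- (th i * y)) *
     \prod_(0 <= j < l) expR (- (r j * (1 - expR (- (th i * a j)))))) *:
     expR (- (r l * (1 - expR (- (th i * a l)))))).
  rewrite /Psi; apply: eq_bigr => i _.
  by rewrite big_nat_recr//= /GRing.scale /= !mulrA.
have -> : series (\sum_(i < m) ((wt i * expR (- (th i * y)) *
     \prod_(0 <= j < l) expR (- (r j * (1 - expR (- (th i * a j)))))) *: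
     (fun q : nat => expR (- ((th i * a l) * q%:R)) * poisson_mass (r l) q)))
  = \sum_(i < m) ((wt i * expR (- (th i * y)) *
     \prod_(0 <= j < l) expR (- (r j * (1 - expR (- (th i * a j)))))) *:
     series (fun q : nat => expR (- ((th i * a l) * q%:R)) * poisson_mass (r l) q)).
  apply/funext => k; rewrite /series/= !fct_sumE.
  rewrite exchange_big/=; apply: eq_bigr => i _.
  by rewrite !fctE scaler_sumr.
rewrite fct_sumE; apply: cvg_sumr => i.
by apply: cvgZ; [exact: cvg_cst|exact: poisson_laplace].
Qed.

Lemma compound_poisson_bounds l y c : (l <= n)%N -> 0 <= y ->
  ((Psi thL l y * \prod_(l <= i < n) poisson_mass (r i) (c i))%:E <= Pr (Ev l y c)
   <= (Psi thU l y * \prod_(l <= i < n) poisson_mass (r i) (c i))%:E)%E.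
Proof.
elim: l y c => [|l IH] y c ln y0.
  have -> : Pr (Ev 0 y c) = (F y * \prod_(0 <= i < n) poisson_mass (r i) (c i))%:E.
    rewrite -(@independent_lt [set w | forall i, (0 <= i < n)%N -> N i w = (c i)%:R%:E]).
    - congr (Pr (_ `&` _)); apply/seteqP; split => w /=;
      by rewrite big_nil adde0 lte_fin.
    - exact: measurable_fix.
    - exact: indepN.
  rewrite !lee_fin /Psi.
  have p0 : 0 <= \prod_(0 <= i < n) poisson_mass (r i) (c i).
    by apply: prodr_ge0 => i _; exact: poisson_mass_ge0.
  apply/andP; split; apply: ler_wpM2r => //.
    apply: le_trans (FL y0); rewrite le_eqVlt; apply/orP; left; apply/eqP.
    by apply: eq_bigr => i _; rewrite big_nil mulr1.
  apply: le_trans (FU y0) _; rewrite le_eqVlt; apply/orP; left; apply/eqP.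
  by apply: eq_bigr => i _; rewrite big_nil mulr1.
pose B q := [set w | N l w = q%:R%:E].
have mB q : measurable (B q).
  rewrite (_ : B q = N l @^-1` [set q%:R%:E]) //.
  by rewrite -[X in measurable X]setTI; apply: mN => //; exact: emeasurable_set1.
pose cq q i := if i == l then q else c i.
(* Freezing count [l] at [q] moves [a l * q] into the shift, which leads back to the induction
   hypothesis. *)
have EvB q : Ev l.+1 y c `&` B q = Ev l (y + a l * q%:R) (cq q).
  apply/seteqP; split => w /=.
    move=> [[h1 h2] h3]; split.
      move: h1 => /=; rewrite big_nat_recr//= h3 EFinD EFinM -addeA [X in (_ + X)%E]addeC.
      by [].
    move=> i /= /andP[li iN]; rewrite /cq; case: eqP => [->//|/eqP nil].
    by apply: h2; rewrite iN andbT ltn_neqAle eq_sym nil.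
  move=> [/= h1 h2]; have Bq : N l w = q%:R%:E by rewrite h2 ?leqnn//= /cq eqxx.
  split => //; split => /=.
    by rewrite big_nat_recr//= Bq [X in (_ < _ + X)%E]addeC addeA -EFinM -EFinD.
  move=> i /andP[li iN]; rewrite h2 ?iN ?(ltnW li)// /cq.
  by case: eqP li => // ->; rewrite ltnn.
have tB : trivIset setT (fun q => Ev l.+1 y c `&` B q).
  apply/trivIsetP => i j _ _ ij; apply/seteqP; split => // w [[_ h1] [_ h2]].
  move: h2; rewrite /B/= h1 => -[] /eqP; rewrite eqr_nat => /eqP.
  by move/eqP; rewrite (negbTE ij).
(* By [N_nat] the count is almost surely a natural number, so the sets [B q] exhaust the event up to
   a null set. *)
have PE : Pr (Ev l.+1 y c) = Pr (\bigcup_q (Ev l.+1 y c `&` B q)).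
  rewrite -setI_bigcupr.
  have mU : measurable (\bigcup_q B q) by exact: bigcupT_measurable.
  rewrite [in LHS](_ : Ev l.+1 y c = (Ev l.+1 y c `&` \bigcup_q B q) `|`
     (Ev l.+1 y c `&` ~` \bigcup_q B q)); last by rewrite -setIUr setUv setIT.
  rewrite measureU; last 3 first.
  - by apply: measurableI.
  - by apply: measurableI => //; exact: measurableC.
  - by apply/seteqP; split => // w [[_ h] [_ h']].
  rewrite [X in (_ + X)%E](_ : _ = 0%E) ?adde0//.
  apply/eqP; rewrite eq_le measure_ge0 andbT.
  have <- : Pr (~` \bigcup_q B q) = 0%E.
    by rewrite probability_setC// N_nat// subee.
  apply: le_measure; rewrite ?inE//.
  - by apply: measurableI => //; exact: measurableC.
  - exact: measurableC.
have cP : (\sum_(0 <= q < k) Pr (Ev l.+1 y c `&` B q))%E @[k --> \oo] --> Pr (Ev l.+1 y c).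
  rewrite PE; apply: measure_semi_sigma_additive => //.
  - by move=> q; exact: measurableI.
  - by apply: bigcupT_measurable => q; exact: measurableI.
have p0 : 0 <= \prod_(l.+1 <= i < n) poisson_mass (r i) (c i).
  by apply: prodr_ge0 => i _; exact: poisson_mass_ge0.
have prodq q : \prod_(l <= i < n) poisson_mass (r i) (cq q i) =
    poisson_mass (r l) q * \prod_(l.+1 <= i < n) poisson_mass (r i) (c i).
  rewrite big_ltn// {1}/cq eqxx; congr (_ * _); apply: eq_big_nat => i /andP[li _].
  by rewrite /cq; case: eqP li => // ->; rewrite ltnn.
have cQ th : (\sum_(0 <= q < k) (Psi th l (y + a l * q%:R) * poisson_mass (r l) q *
   \prod_(l.+1 <= i < n) poisson_mass (r i) (c i))%:E)%E @[k --> \oo] -->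
   (Psi th l.+1 y * \prod_(l.+1 <= i < n) poisson_mass (r i) (c i))%:E.
  under eq_fun do rewrite sumEFin -mulr_suml.
  apply: cvg_EFin; first exact: nearW.
  by apply: (@cvgM _ _ _ _ _ _ (Psi th l.+1 y)); [exact: Psi_step|exact: cvg_cst].
have IHq q : ((Psi thL l (y + a l * q%:R) * poisson_mass (r l) q *
   \prod_(l.+1 <= i < n) poisson_mass (r i) (c i))%:E <= Pr (Ev l.+1 y c `&` B q) <=
   (Psi thU l (y + a l * q%:R) * poisson_mass (r l) q *
   \prod_(l.+1 <= i < n) poisson_mass (r i) (c i))%:E)%E.
  have := IH (y + a l * q%:R) (cq q) (ltnW ln).
  by rewrite prodq !mulrA EvB; apply; rewrite addr_ge0// mulr_ge0.
apply/andP; split.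
  apply: (lee_cvg_to (cQ thL) cP); apply: nearW => k.
  by apply: lee_sum => q _; have /andP[] := IHq q.
apply: (lee_cvg_to cP (cQ thU)); apply: nearW => k.
by apply: lee_sum => q _; have /andP[] := IHq q.
Qed.

Lemma compound_poisson_sandwich :
  ((\sum_(i < m) wt i *
      expR (- \sum_(0 <= j < n) r j * (1 - expR (- (thL i * a j)))))%:E
   <= Pr [set w | ((G w)%:E < \sum_(0 <= i < n) (a i)%:E * N i w)%E]
   <= (\sum_(i < m) wt i *
      expR (- \sum_(0 <= j < n) r j * (1 - expR (- (thU i * a j)))))%:E)%E.
Proof.
have := @compound_poisson_bounds n 0 (fun=> 0%N) (leqnn n) (lexx _).
have E th : Psi th n 0 = \sum_(i < m) wt i *
      expR (- \sum_(0 <= j < n) r j * (1 - expR (- (th i * a j)))).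
  rewrite /Psi; apply: eq_bigr => i _; rewrite mulr0 oppr0 expR0 mulr1.
  by rewrite -sumrN expR_sum.
rewrite big_geq// !mulr1 !E (_ : Ev n 0 _ = [set w | ((G w)%:E < \sum_(0 <= i < n) (a i)%:E * N i w)%E])//.
apply/seteqP; split => w; rewrite /Ev/= add0e; first by case.
by move=> h; split => // i /andP[]; rewrite leqNgt => /negP.
Qed.

End compound_poisson.

(** * Sums over configurations and marked intensities *)

Section esum_extra.
Context (R : realType) (T : choiceType).
Local Open Scope ereal_scope.
Implicit Types (S : set T).

(** One inequality holds for every nonnegative scalar by comparing finite subsums; the converse is
    the same inequality for [c^-1], with [c = 0] treated apart. *)
Lemma esumZl S (c : R) (a : T -> \bar R) : (0 <= c)%R -> (forall x, 0 <= a x) ->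
  \esum_(x in S) (c%:E * a x) = c%:E * \esum_(x in S) a x.
Proof.
move=> c0 a0.
have le (c' : R) (b : T -> \bar R) : (0 <= c')%R -> (forall x, 0 <= b x) ->
    \esum_(x in S) (c'%:E * b x) <= c'%:E * \esum_(x in S) b x.
  move=> c'0 b0; apply: ub_ereal_sup => _ [A AS <-].
  rewrite -ge0_mule_fsumr//; apply: lee_pmul => //; first exact: fsume_ge0.
  by apply: ereal_sup_ubound; exists A.
apply/eqP; rewrite eq_le le//=.
have [->|cn0] := eqVneq c 0%R.
  by rewrite mul0e; apply: esum_ge0 => x _; rewrite mul0e.
have {cn0}c0 : (0 < c)%R by rewrite lt_neqAle eq_sym cn0.
rewrite -lee_pdivlMl//.
have {1}-> : a = fun x => (c^-1)%:E * (c%:E * a x).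
  by apply/funext => x; rewrite muleA -EFinM mulVf ?gt_eqF// mul1e.
apply: le; first by rewrite invr_ge0 ltW.
by move=> x; rewrite mule_ge0// lee_fin ltW.
Qed.

(* [esum] is a supremum over finite subfamilies, hence ignores negative terms. *)
Lemma esum_funepos S (a : T -> \bar R) :
  \esum_(x in S) a x = \esum_(x in S) maxe (a x) 0.
Proof.
apply/eqP; rewrite eq_le; apply/andP; split.
  by apply: le_esum => x _; rewrite le_max lexx.
apply: ub_ereal_sup => _ [A [fA AS] <-].
apply: ereal_sup_ubound; exists (A `&` [set x | 0 <= a x]).
  by split; [exact: finite_setIl|move=> x [/AS]].
rewrite fsbig_mkcondr/=; apply: eq_fsbigr => x _.
rewrite mem_setE/= maxC; case: ifPn => a0; first by apply/esym/max_idPr.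
by apply/esym/max_idPl; rewrite ltW// ltNge.
Qed.

(** Two suprema are exchanged: over finite subfamilies, where sums converge termwise, and over [n].
    No countability of [S] enters. *)
Lemma esum_monotone_cvg S (f : nat -> T -> R) (g : T -> R) :
  (forall n x, (0 <= f n x)%R) -> (forall x, nondecreasing_seq (f ^~ x)) ->
  (forall x, f n x @[n --> \oo] --> g x) ->
  \esum_(x in S) (f n x)%:E @[n --> \oo] --> \esum_(x in S) (g x)%:E.
Proof.
move=> f0 ndf fg.
have fleg n x : (f n x <= g x)%R.
  have /cvg_lim <- // := fg x.
  apply: nondecreasing_cvgn_le; first exact: ndf.
  by apply/cvg_ex; exists (g x); exact: fg.
have nd : nondecreasing_seq (fun n => \esum_(x in S) (f n x)%:E).
  by move=> n m nm; apply: le_esum => x _; rewrite lee_fin; exact: ndf.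
have -> : \esum_(x in S) (g x)%:E = ereal_sup (range (fun n => \esum_(x in S) (f n x)%:E)).
  apply/eqP; rewrite eq_le; apply/andP; split; last first.
    apply: ub_ereal_sup => _ [n _ <-]; apply: le_esum => x _.
    by rewrite lee_fin.
  apply: ub_ereal_sup => _ [A [fA AS] <-].
  have cA : \sum_(x \in A) (f n x)%:E @[n --> \oo] --> \sum_(x \in A) (g x)%:E.
    rewrite fsbig_finite//=; under eq_fun do rewrite fsbig_finite//=.
    apply: cvg_nnesum => x _; first by apply: nearW => n; rewrite lee_fin.
    by apply: cvg_EFin; [exact: nearW|exact: fg].
  apply: (cvge_to_le cA); apply: nearW => n.
  apply: le_trans (_ : \esum_(x in S) (f n x)%:E <= _).
    by apply: ereal_sup_ubound; exists A.
  by apply: ereal_sup_ubound; exists n.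
exact: ereal_nondecreasing_cvgn.
Qed.

End esum_extra.

Section lebesgue2.
Context (R : realType).
Local Notation leb := (@lebesgue_measure R).

(** Named so that it can carry its own sigma-finite structure, for use with Tonelli on the product
    with the mark axis. *)
Definition lebesgue2 := (leb \x leb)%E.

HB.instance Definition _ := Measure.on lebesgue2.

Let lebesgue2_sigma_finite : sigma_finite setT lebesgue2.
Proof.
exists (fun n => `[- n%:R, n%:R]%classic `*` `[- n%:R, n%:R]%classic).
  rewrite predeqE => -[x y]; split => // _.
  exists (Num.truncn (Num.max `|x| `|y|)).+1 => //.
  have := truncnS_gt (Num.max `|x| `|y|).
  by rewrite gt_max => /andP[hx hy]; split; rewrite /= in_itv/= -ler_norml ltW.
move=> n; split; first by apply: measurableX; exact: measurable_itv.
rewrite /lebesgue2 product_measure1E; try exact: measurable_itv.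
have h : (leb (`[(- n%:R)%R, n%:R%R]%classic : set R) < +oo)%E.
  by rewrite lebesgue_measure_itv/=; case: ifP => _; rewrite ?ltry// -EFinD ltry.
by apply: lte_mul_pinfty => //; rewrite ge0_fin_numE.
Qed.

HB.instance Definition _ :=
  Measure_isSigmaFinite.Build _ _ _ lebesgue2 lebesgue2_sigma_finite.

End lebesgue2.

Section mark_intensity.
Context (R : realType).
Local Notation leb := (@lebesgue_measure R).
Local Notation leb3 := (@lebesgue2 R \x leb)%E.

(** The indicator moves the restriction to nonnegative marks from the domain into the integrand, so
    that intensities become integrals over the whole product space. *)
Definition mark_density (p : pt R) : R := expR (- p.2) * \1_(`[0%R, +oo[%classic) p.2.

Lemma mark_density_ge0 p : 0 <= mark_density p.
Proof. by rewrite /mark_density mulr_ge0// expR_ge0. Qed.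

Lemma measurable_mark_density : measurable_fun setT mark_density.
Proof.
apply: measurable_funM.
  by apply: measurableT_comp; first exact: measurable_expR; exact: measurableT_comp.
apply: measurableT_comp; last exact: measurable_snd.
by apply: measurable_indic; exact: measurable_itv.
Qed.

Lemma integral_leb3 (h : pt R -> \bar R) : measurable_fun setT h ->
  (forall p, (0 <= h p)%E) ->
  (\int[leb3]_p h p = \int[leb]_y1 \int[leb]_y2 \int[leb]_v h ((y1, y2), v))%E.
Proof.
move=> mh h0; rewrite (@fubini_tonelli1 _ _ _ _ R (@lebesgue2 R) leb h mh h0).
have mF : measurable_fun setT (fubini_F leb h).
  exact: measurable_fun_fubini_tonelli_F.
have F0 x : (0 <= fubini_F leb h x)%E by exact: integral_ge0.
exact: (@fubini_tonelli1 _ _ _ _ R leb leb _ mF F0).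
Qed.

Lemma mpp_intensityE (c : R) (A : set (pt R)) : measurable A ->
  mpp_intensity c A = (c%:E * \int[leb3]_p (\1_A p * mark_density p)%:E)%E.
Proof.
move=> mA; rewrite integral_leb3; last 2 first.
- apply/measurable_EFinP/measurable_funM; last exact: measurable_mark_density.
  exact: measurable_indic.
- by move=> p; rewrite lee_fin mulr_ge0// mark_density_ge0.
rewrite /mpp_intensity.
set u := (X in (_ * X)%E = _); set v := (X in _ = (_ * X)%E).
suff -> : u = v by [].
rewrite /u /v; apply: eq_integral => y1 _; apply: eq_integral => y2 _.
rewrite integral_mkcond; apply: eq_integral => w _.
rewrite patchE /mark_density/= !indicE.
by case: (w \in _); rewrite ?mulr1// !mulr0.
Qed.

Lemma measurable_weighted (h : pt R -> R) th : measurable_fun setT h ->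
  measurable_fun setT (fun p => ((1 - expR (- (th * h p))) * mark_density p)%:E).
Proof.
move=> mh; apply/measurable_EFinP; apply: measurable_funM; last first.
  exact: measurable_mark_density.
apply: measurable_funB; first exact: measurable_cst.
apply: measurableT_comp; first exact: measurable_expR.
apply: measurableT_comp; first exact: oppr_measurable.
by apply: measurable_funM => //; exact: measurable_cst.
Qed.

End mark_intensity.

(** * The Laplace functional *)

Section laplace_functional.
Context (R : realType) (K : nat) (d : measure_display) (Om : measurableType d).
Variables (Pr : probability Om R) (G : Om -> R) (F : R -> R).
Hypothesis mG : measurable_fun setT G.
Hypothesis cdfG : forall t, Pr [set w | G w <= t] = (F t)%:E.
Hypothesis contF : continuous F.
Variables (Phi : 'I_K -> Om -> set (pt R)) (cc : 'I_K -> R).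
Hypothesis cc0 : forall j, 0 <= cc j.
Hypothesis mcnt : forall j (A : set (pt R)), measurable A ->
  measurable_fun [set: Om] (fun w : Om => cnt (Phi j w) A : \bar R).
Hypothesis indep_counts : forall (n : nat) (tier : 'I_n -> 'I_K)
    (A : 'I_n -> set (pt R)) (c : 'I_n -> nat) (t : R),
  (forall i, measurable (A i)) ->
  (forall i, (mpp_intensity (cc (tier i)) (A i) < +oo)%E) ->
  (forall i i', i != i' -> tier i = tier i' -> A i `&` A i' = set0) ->
  Pr [set w | (G w <= t)%R /\ forall i, cnt (Phi (tier i) w) (A i) = (c i)%:R%:E] =
  (Pr [set w | (G w <= t)%R] *
   \prod_(i < n) (poisson_mass (fine (mpp_intensity (cc (tier i)) (A i))) (c i))%:E)%E.

Local Notation leb3 := (@lebesgue2 R \x @lebesgue_measure R)%E.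

Lemma mpp_intensity_ge0 (c : R) A : 0 <= c -> (0 <= mpp_intensity c A)%E.
Proof.
move=> c0; apply: mule_ge0; first by rewrite lee_fin.
do 3 (apply: integral_ge0 => ? _).
by rewrite lee_fin mulr_ge0// expR_ge0.
Qed.

(** Counts live in [\bar R]; their values at natural numbers have Poisson probabilities, which
    already sum to one and leave no mass at infinity. *)
Lemma count_nat j (A : set (pt R)) : measurable A ->
  (mpp_intensity (cc j) A < +oo)%E ->
  Pr (\bigcup_q [set w | cnt (Phi j w) A = q%:R%:E]) = 1%E.
Proof.
move=> mA A_fin.
pose B q := [set w | cnt (Phi j w) A = q%:R%:E :> \bar R].
have mB q : measurable (B q).
  rewrite (_ : B q = (fun w => cnt (Phi j w) A) @^-1` [set q%:R%:E]) //.
  by rewrite -[X in measurable X]setTI; apply: mcnt => //; exact: emeasurable_set1.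
have PB q : Pr (B q) = (poisson_mass (fine (mpp_intensity (cc j) A)) q)%:E.
  apply: (independent_total mG cdfG (mB q)) => t.
  have := @indep_counts 1 (fun=> j) (fun=> A) (fun=> q) t (fun=> mA) (fun=> A_fin).
  rewrite big_ord1 cdfG -EFinM => <-; last first.
    by move=> i i'; rewrite !ord1.
  congr (Pr _); apply/seteqP; split => w /= [h1 h2]; split => //.
  exact: (h2 ord0).
have cB : (\sum_(0 <= q < n) Pr (B q))%E @[n --> \oo] --> Pr (\bigcup_q B q).
  apply: measure_semi_sigma_additive => //; last exact: bigcupT_measurable.
  apply/trivIsetP => i i' _ _ ii'; apply/seteqP; split => // w [].
  rewrite /B/= => -> [] /eqP; rewrite eqr_nat => /eqP.
  by move/eqP; rewrite (negbTE ii').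
apply: (cvg_unique _ cB) => //=.
under eq_fun do under eq_bigr do rewrite PB.
under eq_fun do rewrite sumEFin.
apply: cvg_EFin; first exact: nearW.
exact: poisson_mass_total.
Qed.

Variable f : 'I_K -> pt R -> R.
Hypothesis f_ge0 : forall j p, 0 <= f j p.
Hypothesis mf : forall j, measurable_fun setT (f j).

Let mfE j : measurable_fun setT (EFin \o f j).
Proof. exact/measurable_EFinP. Qed.

Import HBNNSimple.

Let g j n : {nnsfun pt R >-> R} := nnsfun_approx measurableT (mfE j) n.

Let g_ge0 j n p : 0 <= g j n p.
Proof. exact: fun_ge0. Qed.

Let g_nd j p : nondecreasing_seq (fun n => g j n p).
Proof. by move=> m n mn; exact/lefP/nd_nnsfun_approx. Qed.

Let g_cvg j p : g j n p @[n --> \oo] --> f j p.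
Proof.
have h0 x : [set: pt R] x -> (0 <= (EFin \o f j) x)%E by rewrite lee_fin.
have := cvg_nnsfun_approx measurableT (mfE j) h0 (Logic.I : [set: pt R] p).
by move/fine_cvg.
Qed.

Let g_le j n p : g j n p <= f j p.
Proof.
have /cvg_lim <- // := @g_cvg j p.
apply: nondecreasing_cvgn_le; first exact: g_nd.
by apply/cvg_ex; exists (f j p); exact: g_cvg.
Qed.

(** The value zero is left out: its level set may have infinite intensity, and it contributes
    nothing to the sums. *)
Let vals j n : seq R := [seq v <- finmap.enum_fset (fset_set (range (g j n))) | v != 0].
Let lev j n v : set (pt R) := g j n @^-1` [set v].

Let measurable_lev j n v : measurable (lev j n v).
Proof.
by rewrite -[X in measurable X]setTI; exact: (measurable_funPT (g j n)).
Qed.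

Let uniq_vals j n : uniq (vals j n).
Proof. exact/filter_uniq/finmap.fset_uniq. Qed.

Let vals_gt0 j n v : v \in vals j n -> 0 < v.
Proof.
rewrite mem_filter => /andP[v0]; rewrite in_fset_set// inE => -[p _ gv].
by rewrite lt_neqAle eq_sym v0/= -gv; exact: g_ge0.
Qed.

(** The condition [h 0 = 0] compensates for the missing zero level. It is met by the two instances
    needed, the identity and [1 - expR (- (th * x))]. *)
Let simple_decomp (h : R -> R) j n p : h 0 = 0 ->
  h (g j n p) = \sum_(v <- vals j n) h v * \1_(lev j n v) p.
Proof.
move=> h0; have levE v : \1_(lev j n v) p = (v == g j n p)%:R :> R.
  rewrite indicE; suff -> : (p \in lev j n v) = (v == g j n p) by [].
  apply/idP/idP; first by rewrite inE /lev/= => ->.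
  by move=> /eqP ->; rewrite inE.
under eq_bigr do rewrite levE.
have [gp|gp] := eqVneq (g j n p) 0.
  rewrite gp h0 big_seq big1// => v vv.
  by rewrite gt_eqF ?mulr0// (vals_gt0 vv).
have gv : g j n p \in vals j n.
  by rewrite mem_filter gp in_fset_set// inE.
rewrite (bigD1_seq _ gv)//= eqxx mulr1 big1 ?addr0// => v vn.
by rewrite (negbTE vn) mulr0.
Qed.

Let esum_simple j n (S : set (pt R)) :
  \esum_(p in S) (g j n p)%:E = (\sum_(v <- vals j n) v%:E * cnt S (lev j n v))%E.
Proof.
(* [Num.max v 0] equals [v] on [vals j n] and is nonnegative for every [v], so the sums can be
   exchanged without carrying membership along. *)
have -> : (fun p => (g j n p)%:E) =
    (fun p => \sum_(v <- vals j n) (Num.max v 0)%:E * (\1_(lev j n v) p)%:E)%E.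
  apply/funext => p; rewrite {1}(@simple_decomp id j n p erefl) -sumEFin.
  rewrite !big_seq; apply: eq_bigr => v vv.
  by rewrite EFinM max_l// ltW// (vals_gt0 vv).
rewrite esum_sum; last first.
  by move=> p v _ _; rewrite mule_ge0// lee_fin le_max lexx orbT.
rewrite !big_seq; apply: eq_bigr => v vv.
rewrite esumZl; last 2 first.
- by rewrite le_max lexx orbT.
- by move=> p; rewrite lee_fin.
rewrite max_l ?(ltW (vals_gt0 vv))//; congr (_ * _)%E.
rewrite /cnt esum_mkcondr; apply: eq_esum => p _.
by rewrite indicE; case: (p \in _).
Qed.

Variable Lam : 'I_K -> R -> R.
Hypothesis LamE : forall j th, 0 <= th ->
  ((cc j)%:E * \int[leb3]_p ((1 - expR (- (th * f j p))) * mark_density p)%:E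
   = (Lam j th)%:E)%E.

Let onem_ge0 (th x : R) : 0 <= th -> 0 <= x -> 0 <= 1 - expR (- (th * x)).
Proof.
move=> th0 x0; rewrite subr_ge0 -expR0 ler_expR oppr_le0; exact: mulr_ge0.
Qed.

Let measurable_levd j n v :
  measurable_fun setT (fun p => (\1_(lev j n v) p * mark_density p)%:E).
Proof.
apply/measurable_EFinP; apply: measurable_funM; last exact: measurable_mark_density.
exact: measurable_indic.
Qed.

Let levd_ge0 j n v p : (0 <= (\1_(lev j n v) p * mark_density p)%:E)%E.
Proof. by rewrite lee_fin mulr_ge0// mark_density_ge0. Qed.

(** A Markov bound: on the level set of [v] one has [f >= g = v], so [1 - expR (- v)] times its
    intensity is at most the finite number [Lam j 1]. *)
Let mpp_lev_fin j n v : v \in vals j n ->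
  (mpp_intensity (cc j) (lev j n v) < +oo)%E.
Proof.
move=> vv; have v0 := vals_gt0 vv.
have e0 : 0 < 1 - expR (- v) by rewrite subr_gt0 -expR0 ltr_expR oppr_lt0.
have le : ((1 - expR (- v))%:E * mpp_intensity (cc j) (lev j n v) <= (Lam j 1)%:E)%E.
  rewrite mpp_intensityE// muleCA -ge0_integralZl//; last 2 first.
  - exact: measurable_levd.
  - by rewrite lee_fin ltW.
  rewrite -LamE//; apply: lee_wpmul2l; first by rewrite lee_fin.
  apply: ge0_le_integral => //.
  - by move=> p _; apply: mule_ge0 => //; rewrite lee_fin ltW.
  - by apply: measurable_funeM; exact: measurable_levd.
  - exact: measurable_weighted.
  move=> p _; rewrite -EFinM lee_fin mulrA; apply: ler_wpM2r.
    exact: mark_density_ge0.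
  rewrite indicE; have [pv|_] := boolP (p \in lev j n v); last first.
    by rewrite mulr0; exact: onem_ge0.
  rewrite mulr1 mul1r lerD2l lerN2 ler_expR lerN2.
  by move: pv; rewrite inE /lev/= => <-.
rewrite ltNge leye_eq; apply/eqP => Ioo.
by move: le; rewrite Ioo gt0_muley ?lte_fin// leye_eq.
Qed.

Let LamN n j th := \sum_(v <- vals j n)
  fine (mpp_intensity (cc j) (lev j n v)) * (1 - expR (- (th * v))).

Let LamNE n j th : 0 <= th ->
  ((cc j)%:E * \int[leb3]_p ((1 - expR (- (th * g j n p))) * mark_density p)%:E
   = (LamN n j th)%:E)%E.
Proof.
move=> th0.
have -> : (fun p => ((1 - expR (- (th * g j n p))) * mark_density p)%:E) =
  (fun p => \sum_(v <- vals j n) (Num.max (1 - expR (- (th * v))) 0)%:E *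
     (\1_(lev j n v) p * mark_density p)%:E)%E.
  apply/funext => p.
  rewrite (@simple_decomp (fun x => 1 - expR (- (th * x))) j n p); last first.
    by rewrite mulr0 oppr0 expR0 subrr.
  rewrite mulr_suml -sumEFin !big_seq; apply: eq_bigr => v vv.
  by rewrite -mulrA EFinM max_l// onem_ge0// ltW// (vals_gt0 vv).
rewrite ge0_integral_sum//; last 2 first.
- by move=> v; apply: measurable_funeM; exact: measurable_levd.
- by move=> v p _; rewrite mule_ge0// lee_fin le_max lexx orbT.
rewrite ge0_sume_distrr; last first.
  move=> v _; apply: integral_ge0 => p _.
  by rewrite mule_ge0// lee_fin le_max lexx orbT.
rewrite /LamN -sumEFin !big_seq; apply: eq_bigr => v vv.
rewrite ge0_integralZl; [|by []|exact: measurable_levd|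
  by move=> p _; exact: levd_ge0|by rewrite lee_fin le_max lexx orbT].
rewrite muleCA -mpp_intensityE// EFinM muleC; congr (_ * _)%E.
  rewrite fineK// ge0_fin_numE ?mpp_lev_fin//; exact: mpp_intensity_ge0.
by rewrite max_l// onem_ge0// ltW// (vals_gt0 vv).
Qed.

Let LamN_cvg j th : 0 <= th -> LamN n j th @[n --> \oo] --> Lam j th.
Proof.
move=> th0.
suff : (LamN n j th)%:E @[n --> \oo] --> (Lam j th)%:E by move/fine_cvg.
rewrite -LamE//; under eq_fun do rewrite -LamNE//.
apply: cvgeZl => //.
have -> : (fun p => ((1 - expR (- (th * f j p))) * mark_density p)%:E) =
   (fun p => limn (fun n => ((1 - expR (- (th * g j n p))) * mark_density p)%:E)).
  apply/funext => p; apply/esym/cvg_lim => //.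
  apply: cvg_EFin; first exact: nearW.
  apply: (@cvgM _ _ _ _ _ _ (1 - expR (- (th * f j p)))); last exact: cvg_cst.
  apply: cvgB; first exact: cvg_cst.
  apply: continuous_cvg; first exact: continuous_expR.
  apply: cvgN; apply: cvgM; first exact: cvg_cst.
  exact: g_cvg.
apply: cvg_monotone_convergence => //.
- by move=> n; exact: measurable_weighted.
- by move=> n p _; rewrite lee_fin mulr_ge0// ?onem_ge0// mark_density_ge0.
move=> p _ m n mn; rewrite lee_fin ler_wpM2r ?mark_density_ge0//.
by rewrite lerD2l lerN2 ler_expR lerN2 ler_wpM2l//; exact: g_nd.
Qed.

Variable k0 : 'I_K.
Variables (m : nat) (wt thL thU : nat -> R).
Hypothesis thL0 : forall i, 0 <= thL i.
Hypothesis thU0 : forall i, 0 <= thU i.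
Hypothesis FL : forall y, 0 <= y -> \sum_(i < m) wt i * expR (- (thL i * y)) <= F y.
Hypothesis FU : forall y, 0 <= y -> F y <= \sum_(i < m) wt i * expR (- (thU i * y)).

Let simple_sandwich n :
  ((\sum_(i < m) wt i * expR (- \sum_(j < K) LamN n j (thL i)))%:E
   <= Pr [set w | ((G w)%:E < \sum_(j < K) \esum_(p in Phi j w) (g j n p)%:E)%E]
   <= (\sum_(i < m) wt i * expR (- \sum_(j < K) LamN n j (thU i)))%:E)%E.
Proof.
(* Pairs of a tier and a level value form one list of Poisson counts. Absence of repetitions makes
   the level sets of a common tier disjoint, as [indep_counts] demands. *)
pose l : seq ('I_K * R) := [seq (j, v) | j <- index_enum 'I_K, v <- vals j n].
have ul : uniq l.
  apply: allpairs_uniq_dep; first exact: index_enum_uniq.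
    by move=> j _; exact: uniq_vals.
  by move=> [j v] [j' v'] _ _ [] -> ->.
have lP p : p \in l -> p.2 \in vals p.1 n.
  by move=> /allpairsPdep[j [v [_ vv ->]]].
(* The default value [0] gives [a i = 0] beyond the list, so nonnegativity holds for all indices;
   [k0] merely supplies some tier. *)
pose x i := nth (k0, 0) l i.
have xl i : (i < size l)%N -> x i \in l by move=> il; exact: mem_nth.
pose A i := lev (x i).1 n (x i).2.
pose N i w := cnt (Phi (x i).1 w) (A i) : \bar R.
pose r i := fine (mpp_intensity (cc (x i).1) (A i)).
pose a i := (x i).2.
have a0 i : 0 <= a i.
  have [il|il] := ltnP i (size l); last by rewrite /a /x nth_default.
  by rewrite ltW// (@vals_gt0 (x i).1 n)//; exact/lP/xl.
have r0 i : 0 <= r i by apply: fine_ge0; exact: mpp_intensity_ge0.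
have A_fin i : (i < size l)%N -> (mpp_intensity (cc (x i).1) (A i) < +oo)%E.
  by move=> il; apply: mpp_lev_fin; exact/lP/xl.
have N_nat i : (i < size l)%N -> Pr (\bigcup_q [set w | N i w = q%:R%:E]) = 1%E.
  by move=> il; apply: count_nat; [exact: measurable_lev|exact: A_fin].
have indepN (c : nat -> nat) t :
  Pr ([set w | G w <= t] `&` [set w | forall i, (i < size l)%N -> N i w = (c i)%:R%:E])
  = (F t * \prod_(0 <= i < size l) poisson_mass (r i) (c i))%:E.
  have := @indep_counts (size l) (fun i => (x i).1) (fun i => A i) (fun i => c i) t.
  rewrite cdfG prodEFin -EFinM big_mkord => <-.
  - congr (Pr _); apply/seteqP; split => w /= [h1 h2]; split => //.
      by move=> i; exact: h2.
    by move=> i il; exact: (h2 (Ordinal il)).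
  - by move=> i; exact: measurable_lev.
  - by move=> i; exact: A_fin.
  move=> i i' ii' xi; apply/seteqP; split => // p [].
  rewrite /A /lev/= -xi => -> x2.
  have : x i == x i' by rewrite (surjective_pairing (x i)) (surjective_pairing (x i')) xi x2.
  by rewrite /x nth_uniq// -[_ == _ :> nat]/(i == i') (negbTE ii').
have := @compound_poisson_sandwich R d Om Pr G F mG contF (size l) N r a _ r0 a0
   N_nat indepN m wt thL thU FL FU.
have -> : [set w | ((G w)%:E < \sum_(0 <= i < size l) (a i)%:E * N i w)%E] =
  [set w | ((G w)%:E < \sum_(j < K) \esum_(p in Phi j w) (g j n p)%:E)%E].
  congr mkset; apply/funext => w; congr (_ < _)%E.
  rewrite -(big_nth (k0, 0) xpredT (fun p => p.2%:E * cnt (Phi p.1 w) (lev p.1 n p.2))%E).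
  rewrite big_allpairs_dep/=; apply: eq_bigr => j _.
  by rewrite esum_simple.
have sE th : \sum_(0 <= j < size l) r j * (1 - expR (- (th * a j))) =
    \sum_(j < K) LamN n j th.
  rewrite -(big_nth (k0, 0) xpredT (fun p => fine (mpp_intensity (cc p.1) (lev p.1 n p.2)) *
     (1 - expR (- (th * p.2))))).
  by rewrite big_allpairs_dep.
have sumE th : \sum_(i < m) wt i *
      expR (- \sum_(0 <= j < size l) r j * (1 - expR (- (th i * a j)))) =
    \sum_(i < m) wt i * expR (- \sum_(j < K) LamN n j (th i)).
  by apply: eq_bigr => i _; rewrite sE.
rewrite (sumE thL) (sumE thU).
by apply => i; apply: mcnt; exact: measurable_lev.
Qed.

Lemma laplace_sandwich :
  ((\sum_(i < m) wt i * expR (- \sum_(j < K) Lam j (thL i)))%:E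
   <= Pr [set w | ((G w)%:E < \sum_(j < K) \esum_(p in Phi j w) (f j p)%:E)%E]
   <= (\sum_(i < m) wt i * expR (- \sum_(j < K) Lam j (thU i)))%:E)%E.
Proof.
pose S n w := (\sum_(j < K) \esum_(p in Phi j w) (g j n p)%:E)%E.
pose S' w := (\sum_(j < K) \esum_(p in Phi j w) (f j p)%:E)%E.
pose E n := [set w | ((G w)%:E < S n w)%E].
have SS' n w : (S n w <= S' w)%E.
  by apply: lee_sum => j _; apply: le_esum => p _; rewrite lee_fin.
have cS w : S n w @[n --> \oo] --> S' w.
  apply: cvg_nnesum => j _.
    by apply: nearW => n; apply: esum_ge0 => p _; rewrite lee_fin.
  by apply: esum_monotone_cvg.
(* If no [S n w] exceeded [G w], neither would their limit; this also covers an infinite limit. *)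
have UE : [set w | ((G w)%:E < S' w)%E] = \bigcup_n E n.
  apply/seteqP; split => [w /= GS|w [n _ /= h]]; last exact: lt_le_trans h (SS' n w).
  apply: contrapT => h; move: GS; apply/negP; rewrite -leNgt.
  apply: (cvge_to_le (cS w)); apply: nearW => n.
  by rewrite leNgt; apply/negP => h'; apply: h; exists n.
have mS n : measurable_fun setT (S n).
  apply: emeasurable_sum => j.
  under eq_fun do rewrite esum_simple.
  by apply: emeasurable_sum => v; apply: measurable_funeM; exact: mcnt.
have mE n : measurable (E n) by apply: measurable_lt_EFin.
have cE : Pr (E n) @[n --> \oo] --> Pr (\bigcup_n E n).
  apply: nondecreasing_cvg_mu => //; first exact: bigcupT_measurable.
  move=> n n' nn'; apply/subsetPset => w /= h; apply: lt_le_trans h _.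
  by apply: lee_sum => j _; apply: le_esum => p _; rewrite lee_fin; exact: g_nd.
have cb th : (forall i, 0 <= th i) ->
   (\sum_(i < m) wt i * expR (- \sum_(j < K) LamN n j (th i)))%:E @[n --> \oo] -->
   (\sum_(i < m) wt i * expR (- \sum_(j < K) Lam j (th i)))%:E.
  move=> th0; apply: cvg_EFin; first exact: nearW.
  rewrite /comp/=; apply: (cvg_sumr (f := fun (i : 'I_m) n => wt i * expR (- \sum_(j < K) LamN n j (th i)))) => i.
  apply: cvgM; first exact: cvg_cst.
  apply: continuous_cvg; first exact: continuous_expR.
  apply: cvgN; apply: (cvg_sumr (f := fun (j : 'I_K) n => LamN n j (th i))) => j.
  exact: LamN_cvg.
rewrite UE; apply/andP; split.
  apply: (lee_cvg_to (cb _ thL0) cE); apply: nearW => n.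
  by have /andP[] := simple_sandwich n.
apply: (lee_cvg_to cE (cb _ thU0)); apply: nearW => n.
by have /andP[] := simple_sandwich n.
Qed.

End laplace_functional.

(** * Alzer's inequality *)

Section derivatives.
Context (R : realType).
Implicit Types (f g : R -> R) (x a b : R).

Lemma is_derive1_eq f x a b : is_derive x (1 : R) f a -> a = b ->
  is_derive x (1 : R) f b.
Proof. by move=> ? <-. Qed.

Lemma is_derive1_id x : is_derive x (1 : R) (fun t => t) (1 : R).
Proof. exact: is_derive_id. Qed.

Lemma is_derive1D f g x a b : is_derive x (1 : R) f a -> is_derive x (1 : R) g b ->
  is_derive x (1 : R) (fun t => f t + g t) (a + b).
Proof. exact: is_deriveD. Qed.

Lemma is_derive1B f g x a b : is_derive x (1 : R) f a -> is_derive x (1 : R) g b ->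
  is_derive x (1 : R) (fun t => f t - g t) (a - b).
Proof. exact: is_deriveB. Qed.

Lemma is_derive1M f g x a b : is_derive x (1 : R) f a -> is_derive x (1 : R) g b ->
  is_derive x (1 : R) (fun t => f t * g t) (a * g x + f x * b).
Proof.
move=> fa gb; apply: (is_derive1_eq (is_deriveM fa gb)).
by rewrite /GRing.scale/= addrC [a * _]mulrC.
Qed.

Lemma is_derive1_cst c x : is_derive x (1 : R) (fun=> c : R) (0 : R).
Proof. exact: is_derive_cst. Qed.

Lemma is_derive1Z f c x a : is_derive x (1 : R) f a ->
  is_derive x (1 : R) (fun t => c * f t) (c * a).
Proof. exact: is_deriveZ. Qed.

Lemma is_derive1X f n x a : is_derive x (1 : R) f a ->
  is_derive x (1 : R) (fun t => f t ^+ n) (n%:R * f x ^+ n.-1 * a).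
Proof. by move=> fa; have := is_deriveX n fa; rewrite exprfctE. Qed.

Lemma is_derive1_expR f x a : is_derive x (1 : R) f a ->
  is_derive x (1 : R) (fun t => expR (f t)) (a * expR (f x)).
Proof.
move=> fa; apply: (is_derive1_eq (is_derive1_comp (is_derive_expR (f x)) fa)).
by rewrite mulrC.
Qed.

Lemma is_derive1_expRZ c x : is_derive x (1 : R) (fun t => expR (c * t)) (c * expR (c * x)).
Proof.
apply: is_derive1_expR; rewrite -[X in is_derive _ _ _ X]mulr1.
by apply: is_derive1Z; exact: is_derive1_id.
Qed.

Lemma mean_value f (df : R -> R) a b : a < b ->
  (forall x, is_derive x (1 : R) f (df x)) ->
  exists2 c, a < c < b & f b - f a = df c * (b - a).
Proof.
move=> ab fdf; have [|c] := @MVT R f df a b ab (fun x _ => fdf x).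
  apply: continuous_subspaceT => x.
  by apply/differentiable_continuous/derivable1_diffP; have [] := fdf x.
by rewrite in_itv/= => cab fE; exists c.
Qed.

(* If [f] starts at [0], tends to [0], and can only pass from increasing to
   decreasing, it cannot be negative: it would then decrease forever. *)
Lemma hump_ge0 f (df : R -> R) : (forall x, is_derive x (1 : R) f (df x)) ->
  f 0 = 0 -> f n%:R @[n --> \oo] --> (0 : R) ->
  (forall x y, 0 < x -> x < y -> df x < 0 -> df y <= 0) ->
  forall z, 0 <= z -> 0 <= f z.
Proof.
move=> fdf f0 foo S z; rewrite le_eqVlt => /predU1P[<-|z0]; first by rewrite f0.
rewrite leNgt; apply/negP => fz.
have [x /andP[x0 xz] E] := mean_value z0 fdf.
have dx : df x < 0.
  move: E; rewrite f0 !subr0 => E; rewrite -(pmulr_llt0 _ z0) -E//.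
have dec y : z <= y -> f y <= f z.
  rewrite le_eqVlt => /predU1P[<-//|zy].
  have [w /andP[zw wy] E'] := mean_value zy fdf.
  rewrite -subr_le0 E' mulr_le0_ge0 ?subr_ge0 ?(ltW zy)//.
  by apply: (S x) => //; exact: lt_trans zw.
have : 0 <= f z.
  apply: (cvgr_to_le foo); near=> n; apply: dec.
  near: n; exact: nbhs_infty_ger.
by rewrite leNgt fz.
Unshelve. all: by end_near. Qed.

End derivatives.

Lemma invn_cvg0 (R : realType) : (n%:R^-1 : R) @[n --> \oo] --> (0 : R).
Proof. by rewrite -cvg_shiftS; exact: cvg_harmonic. Qed.

(** * The Gamma distribution function in closed form *)

Section gamma_cdf.
Context (R : realType).
Local Notation leb := (@lebesgue_measure R).

(** For [x >= 0], the probability that a Poisson variable of mean [x] is at least [M], which is also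
    the Gamma(M,1) distribution function when [M > 0]. *)
Definition erlang (M : nat) (x : R) : R :=
  1 - expR (- x) * \sum_(i < M) x ^+ i / i`!%:R.

Lemma is_derive_exp_sum M (x : R) :
  is_derive x (1 : R) (fun x : R => \sum_(i < M.+1) x ^+ i / i`!%:R)
    (\sum_(i < M) x ^+ i / i`!%:R).
Proof.
elim: M => [|M IH].
  rewrite big_ord0; under eq_fun do rewrite big_ord1 expr0.
  exact: is_derive_cst.
under eq_fun do rewrite big_ord_recr/=.
rewrite big_ord_recr/=.
apply: is_derive1D => //.
have := is_derive1Z (M.+1`!%:R^-1) (is_derive1X M.+1 (is_derive1_id x)).
under eq_fun do rewrite mulrC.
move=> h; apply: (is_derive1_eq h).
rewrite mulr1 /= factS natrM invfM mulrACA mulVf ?mul1r 1?mulrC//.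
Qed.

(** Differentiating the truncated exponential sum drops its top term, so in the product rule
    everything cancels except that term, the Gamma density. *)
Lemma is_derive_erlang M (x : R) :
  is_derive x (1 : R) (erlang M.+1) (gamma_pdf M.+1 x).
Proof.
rewrite /erlang /gamma_pdf /=.
have dE : is_derive x (1 : R) (fun x : R => expR (- x)) (- expR (- x)).
  have := is_derive1_expRZ (-1) x; rewrite !mulN1r.
  by under eq_fun do rewrite mulN1r.
apply: (is_derive1_eq (is_derive1B (is_derive1_cst 1 x)
  (is_derive1M dE (is_derive_exp_sum M x)))).
rewrite big_ord_recr/=; ring.
Qed.

Lemma erlang0 M : erlang M.+1 0 = 0.
Proof.
rewrite /erlang oppr0 expR0 mul1r big_ord_recl/= expr0 fact0 divr1.
by rewrite big1 ?addr0 ?subrr// => i _; rewrite exprS mul0r mul0r.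
Qed.

Lemma erlang_cvg1 M : erlang M n%:R @[n --> \oo] --> (1 : R).
Proof.
rewrite /erlang -[X in _ --> X]subr0; apply: cvgB; first exact: cvg_cst.
under eq_fun do rewrite mulr_sumr.
have H (i : 'I_M) : expR (- n%:R) * (n%:R ^+ i / i`!%:R) @[n --> \oo] --> (0 : R).
  apply: (@squeeze_cvgr _ _ _ _ (fun=> 0) (fun n => i.+1%:R * (n%:R)^-1)).
  - near=> n.
    have n0 : (0 : R) < n%:R by near: n; exact: nbhs_infty_gtr.
    rewrite mulr_ge0 ?expR_ge0 ?mulr_ge0 ?invr_ge0 ?exprn_ge0//=.
    rewrite expRN mulrC ler_pdivrMr ?expR_gt0//.
    (* The exponential dominates the term of order [i + 1] of its series; comparison with the term
       of order [i] leaves the factor [(i + 1) / n]. *)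
    have h : n%:R ^+ i.+1 / i.+1`!%:R <= expR n%:R :> R.
      by apply: le_trans (expR_ge1Dxn i (ltW n0)); rewrite lerDr.
    apply: le_trans (_ : i.+1%:R / n%:R * (n%:R ^+ i.+1 / i.+1`!%:R) <= _); last first.
      by rewrite ler_wpM2l// divr_ge0.
    rewrite le_eqVlt; apply/orP; left; apply/eqP.
    rewrite factS natrM exprS; field.
    by rewrite !gt_eqF// ltr0n ?fact_gt0.
  - exact: cvg_cst.
  rewrite -[X in _ --> X](mulr0 i.+1%:R); apply: cvgM; first exact: cvg_cst.
  exact: invn_cvg0.
have HS := @cvg_sumr R nat 'I_M _ _ (index_enum _)
  (fun i n => expR (- n%:R) * (n%:R ^+ i / i`!%:R)) (fun=> 0) H.
have E0 : \sum_(i < M) (0 : R) = 0 by rewrite big1.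
by rewrite E0 in HS; exact: HS.
Unshelve. all: by end_near. Qed.

Lemma gamma_cdfE M (t : R) : 0 <= t ->
  (\int[leb]_(x in `[0%R, t]) (gamma_pdf M.+1 x)%:E = (erlang M.+1 t)%:E)%E.
Proof.
rewrite le_eqVlt => /predU1P[<-|t0].
  by rewrite set_itv1 integral_set1 erlang0.
have cE x : {for x, continuous (erlang M.+1)}.
  by apply/differentiable_continuous/derivable1_diffP; have [] := is_derive_erlang M x.
rewrite (@continuous_FTC2 _ _ (erlang M.+1))//; first by rewrite erlang0 sube0.
- apply: continuous_subspaceT => x; rewrite /gamma_pdf.
  apply: cvgM; last exact: cvg_cst.
  apply: cvgM; first exact: exprn_continuous.
  apply: continuous_cvg; first exact: continuous_expR.
  exact: continuousN.
- split.
  + by move=> x _; have [] := is_derive_erlang M x.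
  + apply: cvg_at_right_filter; exact: cE.
  + apply: cvg_at_left_filter; exact: cE.
- by move=> x _; rewrite derive1E; have [_ ->] := is_derive_erlang M x.
Qed.

End gamma_cdf.

(** * The two sides of Alzer's inequality *)

Section alzer.
Context (R : realType).

Lemma is_derive_exp_pow (c : R) n (x : R) :
  is_derive x (1 : R) (fun t => (1 - expR (- (c * t))) ^+ n.+1)
    (n.+1%:R * (1 - expR (- (c * x))) ^+ n * (c * expR (- (c * x)))).
Proof.
under eq_fun do rewrite -mulNr.
apply: (is_derive1_eq (is_derive1X n.+1
  (is_derive1B (is_derive1_cst 1 x) (is_derive1_expRZ (- c) x)))).
by rewrite /= mulNr; congr (_ * _); ring.
Qed.

Lemma exp_pow_cvg1 (c : R) n : 0 < c ->
  (1 - expR (- (c * m%:R))) ^+ n.+1 @[m --> \oo] --> (1 : R).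
Proof.
move=> c0; rewrite -[X in _ --> X](expr1n _ n.+1).
apply: (@continuous_cvg _ _ _ _ _ _ (fun x : R => x ^+ n.+1)); first exact: exprn_continuous.
rewrite -[X in _ --> X]subr0; apply: cvgB; first exact: cvg_cst.
apply: (@squeeze_cvgr _ _ _ _ (fun=> 0) (fun m => c^-1 * (m%:R)^-1)).
- near=> m.
  have m0 : (0 : R) < m%:R by near: m; exact: nbhs_infty_gtr.
  rewrite expR_ge0/= expRN -invfM lef_pV2 ?posrE ?expR_gt0 ?mulr_gt0//.
  by apply: le_trans (expR_ge1Dx _); rewrite mulrC lerDr.
- exact: cvg_cst.
rewrite -[X in _ --> X](mulr0 c^-1); apply: cvgM; first exact: cvg_cst.
exact: invn_cvg0.
Unshelve. all: by end_near. Qed.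

(** This is monotonicity of [(1 - e^-t) / t] with denominators cleared. The difference [f] vanishes
    at [x], and its later slope is nonnegative because [e^x >= 1 + x]. *)
Lemma onemexp_div_nincr (x y : R) : 0 < x -> x < y ->
  (1 - expR (- y)) * x <= (1 - expR (- x)) * y.
Proof.
move=> x0 xy.
pose f (t : R) := (1 - expR (- x)) * t - (1 - expR ((-1) * t)) * x.
pose df (t : R) := (1 - expR (- x)) - expR ((-1) * t) * x.
have dfE t : is_derive t (1 : R) f (df t).
  apply: (is_derive1_eq (is_derive1B (is_derive1Z (1 - expR (- x)) (is_derive1_id t))
   (is_derive1M (is_derive1B (is_derive1_cst 1 t) (is_derive1_expRZ (-1) t)) (is_derive1_cst x t)))).
  by rewrite /df; ring.
have [c /andP[xc cy] E] := mean_value xy dfE.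
have fx : f x = 0 by rewrite /f mulN1r; ring.
have : 0 <= f y.
  have -> : f y = df c * (y - x) by rewrite -E fx subr0.
  rewrite mulr_ge0 ?subr_ge0 ?(ltW xy)// /df mulN1r.
  apply: le_trans (_ : expR (- x) * x <= _).
    by rewrite ler_wpM2r ?(ltW x0)// ler_expR lerN2 ltW.
  rewrite -(ler_pM2l (expR_gt0 x)) mulrA mulrBr -expRD subrr expR0 mul1r mulr1.
  by rewrite lerBrDl expR_ge1Dx.
by rewrite /f subr_ge0 mulN1r.
Qed.

(** Up to the factor [e^-x], the derivative of the difference compares [((1 - e^-x) / x)^M] with
    [1 / (M+1)!]. By [onemexp_div_nincr] that power does not increase, so the derivative stays
    nonpositive once negative and [hump_ge0] applies. *)
Lemma erlang_le M (y : R) : 0 <= y -> erlang M.+1 y <= (1 - expR (- y)) ^+ M.+1.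
Proof.
move=> y0; rewrite -subr_ge0.
pose f (t : R) := (1 - expR (- (1 * t))) ^+ M.+1 - erlang M.+1 t.
suff: 0 <= f y by rewrite /f mul1r.
move: y y0.
apply: (@hump_ge0 _ f (fun x => M.+1%:R * (1 - expR (- (1 * x))) ^+ M * (1 * expR (- (1 * x)))
   - gamma_pdf M.+1 x)).
- by move=> x; apply: is_derive1B; [exact: is_derive_exp_pow|exact: is_derive_erlang].
- by rewrite /f erlang0 ?subr0 ?sub0r mulr0 oppr0 expR0 subrr expr0n ?oppr0.
- rewrite -(subrr 1); apply: cvgB; first exact: exp_pow_cvg1.
  exact: erlang_cvg1.
move=> x y x0 xy; rewrite !mul1r /gamma_pdf /= !subr_lt0 !subr_le0.
have E z : z ^+ M * expR (- z) / M`!%:R = z ^+ M / M`!%:R * expR (- z) by rewrite mulrAC.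
rewrite !E ltr_pM2r ?expR_gt0// ler_pM2r ?expR_gt0// => h.
have y0 := lt_trans x0 xy.
rewrite -(ler_pM2r (exprn_gt0 M x0)).
apply: le_trans (_ : M.+1%:R * (1 - expR (- x)) ^+ M * y ^+ M <= _).
  rewrite -!mulrA ler_wpM2l// -!exprMn lerXn2r ?nnegrE//.
  - by rewrite mulr_ge0 ?(ltW x0)// subr_ge0 -expR0 ler_expR oppr_le0 ltW.
  - by rewrite mulr_ge0 ?(ltW y0)// subr_ge0 -expR0 ler_expR oppr_le0 ltW.
  - exact: onemexp_div_nincr.
apply: le_trans (_ : x ^+ M / M`!%:R * y ^+ M <= _).
  by rewrite ler_pM2r ?exprn_gt0// ltW.
by rewrite mulrAC -mulrA mulrAC mulrCA mulrA.
Qed.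

(* [u] is the sign-determining factor of the derivative in [erlang_ge]; its
   second derivative changes sign at most once, from negative to positive. *)
Lemma exp_gap_once (k x y : R) : let u t := expR (k * t) - expR ((k - 1) * t) - t in
  0 < x -> x < y -> 0 < u x -> 0 <= u y.
Proof.
move=> u x0 xy ux.
pose u1 (t : R) := k * expR (k * t) - (k - 1) * expR ((k - 1) * t) - 1.
pose u2 (t : R) := k * (k * expR (k * t)) - (k - 1) * ((k - 1) * expR ((k - 1) * t)).
have du t : is_derive t (1 : R) u (u1 t).
  exact: (is_derive1B (is_derive1B (is_derive1_expRZ k t)
    (is_derive1_expRZ (k - 1) t)) (is_derive1_id t)).
have du1 t : is_derive t (1 : R) u1 (u2 t).
  rewrite -[u2 t]subr0.
  exact: (is_derive1B (is_derive1B (is_derive1Z k (is_derive1_expRZ k t))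
    (is_derive1Z (k - 1) (is_derive1_expRZ (k - 1) t))) (is_derive1_cst 1 t)).
have u0 : u 0 = 0 by rewrite /u !mulr0 expR0 subrr subr0.
have u10 : u1 0 = 0 by rewrite /u1 !mulr0 expR0; ring.
(* As [u] and [u1] vanish at zero, two mean values descend from [0 < u x] to a point [b < x] with
   [0 < u2 b]. Positivity then propagates to the right of [b] and climbs back to [u1] and [u]. *)
have [a /andP[a0 ax] Ea] := mean_value x0 du.
have u1a : 0 < u1 a by rewrite -(pmulr_lgt0 _ x0) -[x]subr0 -Ea u0 subr0.
have [b /andP[b0 ba] Eb] := mean_value a0 du1.
have u2b : 0 < u2 b by rewrite -(pmulr_lgt0 _ a0) -[a]subr0 -Eb u10 subr0.
have u2E t : u2 t = expR ((k - 1) * t) * (k ^+ 2 * expR t - (k - 1) ^+ 2).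
  rewrite /u2 mulrBr [in RHS]mulrCA -expRD.
  have -> : (k - 1) * t + t = k * t by ring.
  by ring.
have u2pos t : b <= t -> 0 <= u2 t.
  move=> bt; move: u2b; rewrite !u2E pmulr_rgt0 ?expR_gt0// => h.
  rewrite mulr_ge0 ?expR_ge0// (le_trans (ltW h))// lerD2r ler_wpM2l ?sqr_ge0//.
  by rewrite ler_expR.
have u1pos t : a <= t -> 0 <= u1 t.
  rewrite le_eqVlt => /predU1P[<-|at_]; first exact: ltW.
  have [c /andP[ac ct] Ec] := mean_value at_ du1.
  rewrite -(subrK (u1 a) (u1 t)) Ec; apply: addr_ge0; last exact: ltW.
  apply: mulr_ge0; last by rewrite subr_ge0 ltW.
  by apply: u2pos; rewrite ltW// (lt_trans ba).
have [c /andP[xc cy] Ec] := mean_value xy du.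
rewrite -(subrK (u x) (u y)) Ec; apply: addr_ge0; last exact: ltW.
apply: mulr_ge0; last by rewrite subr_ge0 ltW.
by apply: u1pos; rewrite ltW// (lt_trans ax).
Qed.

(** The value of [phi] makes both sides agree to leading order at zero, where each behaves like
    [y^(M+1) / (M+1)!]. *)
Lemma erlang_ge M (phi y : R) : 0 < phi -> phi ^+ M.+1 = M.+1`!%:R^-1 ->
  0 <= y -> (1 - expR (- (phi * y))) ^+ M.+1 <= erlang M.+1 y.
Proof.
(* Shape one gives [phi = 1] and equality; it is separated because [k] below divides by the shape
   minus one. *)
case: M => [|M] phi0 phiM y0.
  move: phiM; rewrite expr1 factS fact0 invr1 => ->.
  by rewrite /erlang big_ord1 expr0 fact0 divr1 mulr1 mul1r expr1.
rewrite -subr_ge0.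
pose f (t : R) := erlang M.+2 t - (1 - expR (- (phi * t))) ^+ M.+2.
suff: 0 <= f y by [].
move: y y0.
apply: (@hump_ge0 _ f (fun x => gamma_pdf M.+2 x -
   M.+2%:R * (1 - expR (- (phi * x))) ^+ M.+1 * (phi * expR (- (phi * x))))).
- by move=> x; apply: is_derive1B; [exact: is_derive_erlang|exact: is_derive_exp_pow].
- by rewrite /f erlang0 ?subr0 ?sub0r mulr0 oppr0 expR0 subrr expr0n ?oppr0.
- rewrite -(subrr 1); apply: cvgB; first exact: erlang_cvg1.
  exact: exp_pow_cvg1.
(* Chosen so that [k * (phi * x) * (M+1) = x - phi * x]: the quotient of the two exponential factors
   of the derivative becomes an exact power of order [M+1], and the comparison reduces to bases. *)
pose k := (phi^-1 - 1) / M.+1%:R.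
pose u (t : R) := expR (k * t) - expR ((k - 1) * t) - t.
pose df x := gamma_pdf M.+2 x -
   M.+2%:R * (1 - expR (- (phi * x))) ^+ M.+1 * (phi * expR (- (phi * x))).
have uE t : u t = expR (k * t) * (1 - expR (- t)) - t.
  by rewrite /u mulrBr mulr1 -expRD; congr (_ - expR _ - _); ring.
have M1 : M.+1%:R != 0 :> R by rewrite pnatr_eq0.
have phin0 : phi != 0 by rewrite gt_eqF.
have MF : M.+1`!%:R != 0 :> R by rewrite pnatr_eq0 -lt0n fact_gt0.
(* The derivative has the sign of [t^n - (e^(k t) (1 - e^-t))^n] at [t = phi x]. *)
have dfE x : df x = expR (- x) / (phi ^+ M.+1 * M.+1`!%:R) *
    ((phi * x) ^+ M.+1 - (expR (k * (phi * x)) * (1 - expR (- (phi * x)))) ^+ M.+1).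
  rewrite /df /gamma_pdf /= [(expR (k * _) * _) ^+ _]exprMn -expRM_natr.
  have -> : k * (phi * x) * M.+1%:R = x - phi * x 
    by rewrite /k mulrAC divfK// mulrBl mul1r mulrA mulVf// mul1r.
  have -> : expR (x - phi * x) = expR x * expR (- (phi * x)) by rewrite expRD.
  have ex : expR (- x) * expR x = 1 by rewrite -expRD addNr expR0.
  have h : M.+2%:R * phi = (phi ^+ M.+1 * M.+1`!%:R)^-1.
    have := phiM; rewrite factS natrM exprS => h.
    apply: (@mulIf _ (phi ^+ M.+1 * M.+1`!%:R)); first by rewrite mulf_neq0// expf_neq0.
    rewrite mulVf ?mulf_neq0 ?expf_neq0//.
    have -> : M.+2%:R * phi * (phi ^+ M.+1 * M.+1`!%:R) = (phi * phi ^+ M.+1) * (M.+2%:R * M.+1`!%:R) by ring.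
    by rewrite h mulVf// mulf_neq0// pnatr_eq0.
  rewrite mulrBr; congr (_ - _).
    rewrite exprMn invfM; field; by rewrite MF expf_neq0.
  have -> : M.+2%:R * (1 - expR (- (phi * x))) ^+ M.+1 * (phi * expR (- (phi * x))) =
    (M.+2%:R * phi) * ((1 - expR (- (phi * x))) ^+ M.+1 * expR (- (phi * x))) by ring.
  rewrite h -[in LHS](mul1r (_ ^+ _ * expR (- (phi * x)))) -ex.
  by ring.
have pos x : 0 < expR (- x) / (phi ^+ M.+1 * M.+1`!%:R).
  by rewrite divr_gt0 ?expR_gt0// mulr_gt0 ?exprn_gt0// ltr0n fact_gt0.
have nn x : 0 < x -> 0 <= expR (k * (phi * x)) * (1 - expR (- (phi * x))).
  move=> x0; rewrite mulr_ge0 ?expR_ge0// subr_ge0 -expR0 ler_expR oppr_le0.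
  by rewrite mulr_ge0 ?ltW.
move=> x y x0 xy; rewrite -![_ - _]/(df _) !dfE.
have y0 := lt_trans x0 xy.
rewrite pmulr_rlt0// pmulr_rle0// subr_lt0 subr_le0 ltr_pXn2r ?nnegrE ?nn ?mulr_ge0 ?(ltW x0) ?(ltW phi0)//.
rewrite ler_pXn2r ?nnegrE ?nn ?mulr_ge0 ?(ltW y0) ?(ltW phi0)//.
rewrite -subr_gt0 -uE -subr_ge0 -[X in _ -> 0 <= X]uE.
apply: exp_gap_once; first by rewrite mulr_gt0.
by rewrite ltr_pM2l.
Qed.

End alzer.

(** * Polar coordinates *)

Section disk.
Context (R : realType).
Local Notation leb := (@lebesgue_measure R).

(** Disk area is linear in the squared radius, so the image of planar Lebesgue measure under
    [sqnorm] has constant density [pi] on the half-line. *)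
Definition sqnorm (y : R * R) : R := y.1 ^+ 2 + y.2 ^+ 2.

Lemma measurable_sqnorm : measurable_fun
  [set: measurableTypeR R * measurableTypeR R] (sqnorm : _ -> measurableTypeR R).
Proof.
apply: measurable_funD; apply: measurable_funX.
- exact: measurable_fst.
- exact: measurable_snd.
Qed.

Lemma sqnorm_ge0 y : 0 <= sqnorm y.
Proof. by rewrite addr_ge0// sqr_ge0. Qed.

Lemma norm2E y : norm2 y = Num.sqrt (sqnorm y).
Proof. by []. Qed.

Lemma integral_cos2 (t : R) :
  (\int[leb]_(x in `[(- (pi / 2))%R, (pi / 2)%R]) (2 * t * cos x ^+ 2)%:E = (pi * t)%:E)%E.
Proof.
pose F (x : R) := t * (x + sin x * cos x).
have dF x : is_derive x (1 : R) F (2 * t * cos x ^+ 2).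
  apply: (is_derive1_eq (is_derive1Z t (is_derive1D (is_derive1_id x)
    (is_derive1M (is_derive_sin x) (is_derive_cos x))))).
  have := cos2Dsin2 x => /eqP; rewrite eq_sym -subr_eq => /eqP h.
  rewrite mulrN -!expr2 -h; ring.
have cF x : {for x, continuous F}.
  by apply/differentiable_continuous/derivable1_diffP; have [] := dF x.
have p2 : 0 < pi / 2 :> R by rewrite divr_gt0// pi_gt0.
have ab : - (pi / 2) < pi / 2 :> R by rewrite gtrN.
rewrite (@continuous_FTC2 _ _ F _ _ ab).
- by rewrite /F cosN sinN cos_pihalf sin_pihalf -EFinB; congr EFin; field.
- apply: continuous_subspaceT => x.
  apply: cvgM; first exact: cvg_cst.
  apply: (@continuous_cvg _ _ _ _ _ _ (fun x : R => x ^+ 2)); first exact: exprn_continuous.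
  exact: continuous_cos.
- split.
  + by move=> x _; have [] := dF x.
  + apply: cvg_at_right_filter; exact: cF.
  + apply: cvg_at_left_filter; exact: cF.
- by move=> x _; rewrite derive1E; have [_ ->] := dF x.
Qed.

(** The substitution [y = sqrt t * sin x] turns the integrand into [2 * t * cos x ^+ 2]; the cosine
    is nonnegative on the range, so the square root opens without absolute value. *)
Lemma integral_semicircle (t : R) : 0 < t ->
  (\int[leb]_(y in `[(- Num.sqrt t)%R, Num.sqrt t]) (2 * Num.sqrt (t - y ^+ 2))%:E
   = (pi * t)%:E)%E.
Proof.
move=> t0; have st0 : 0 < Num.sqrt t by rewrite sqrtr_gt0.
pose F (x : R) : R := Num.sqrt t * sin x.
have dF x : is_derive x (1 : R) F (Num.sqrt t * cos x).
  exact: (is_derive1Z _ (is_derive_sin x)).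
have F'E : F^`()%classic = (fun x => Num.sqrt t * cos x).
  by apply/funext => x; rewrite derive1E; have [_ ->] := dF x.
have cF x : {for x, continuous F}.
  by apply/differentiable_continuous/derivable1_diffP; have [] := dF x.
have cF' x : {for x, continuous F^`()%classic}.
  rewrite F'E; apply: cvgM; first exact: cvg_cst.
  exact: continuous_cos.
have p2 : 0 < pi / 2 :> R by rewrite divr_gt0// pi_gt0.
have Fp : F (pi / 2) = Num.sqrt t by rewrite /F sin_pihalf mulr1.
have Fm : F (- (pi / 2)) = - Num.sqrt t by rewrite /F sinN sin_pihalf mulrN1.
have := @integration_by_substitution_increasing R F (fun y => 2 * Num.sqrt (t - y ^+ 2)) (- (pi / 2)) (pi / 2).
rewrite Fp Fm => ->.
- rewrite -integral_cos2; apply: eq_integral => x; rewrite inE/= in_itv/= => xI.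
  rewrite fctE/= F'E; congr EFin.
  have -> : t - F x ^+ 2 = (Num.sqrt t * cos x) ^+ 2.
    rewrite /F !exprMn sqr_sqrtr ?(ltW t0)// sin2cos2; ring.
  rewrite sqrtr_sqr ger0_norm; last by rewrite mulr_ge0 ?sqrtr_ge0// cos_ge0_pihalf.
  have {3}-> : t = Num.sqrt t ^+ 2 by rewrite sqr_sqrtr// ltW.
  by ring.
- by rewrite le_eqVlt; apply/orP; right; rewrite gtrN.
- by move=> x y xI yI xy; rewrite /F ltr_pM2l// ltr_sin.
- by move=> x _; exact: cF'.
- apply/cvg_ex; exists (F^`()%classic (- (pi / 2))); apply: cvg_at_right_filter; exact: cF'.
- apply/cvg_ex; exists (F^`()%classic (pi / 2)); apply: cvg_at_left_filter; exact: cF'.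
- split.
  + by move=> x _; have [] := dF x.
  + apply: cvg_at_right_filter; exact: cF.
  + apply: cvg_at_left_filter; exact: cF.
- apply: continuous_subspaceT => x.
  apply: cvgM; first exact: cvg_cst.
  apply: (@continuous_cvg _ _ _ _ _ _ (@Num.sqrt R)); first exact: sqrt_continuous.
  apply: cvgB; first exact: cvg_cst.
  exact: exprn_continuous.
Qed.

(** Sections of the disk are intervals of half-length [Num.sqrt (t - y ^+ 2)]. As [Num.sqrt] is zero
    on negative numbers, the formula also covers empty sections and [t <= 0]. *)
Lemma disk_area (t : R) :
  @lebesgue2 R [set y | sqnorm y < t] = (pi * Num.max t 0)%:E.
Proof.
have -> : @lebesgue2 R [set y | sqnorm y < t] =
    (\int[leb]_y (2 * Num.sqrt (t - y ^+ 2))%:E)%E.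
  rewrite /lebesgue2 /product_measure1; apply: eq_integral => y _ /=.
  have -> : xsection [set y | sqnorm y < t] y =
      `](- Num.sqrt (t - y ^+ 2)), Num.sqrt (t - y ^+ 2)[%classic.
    apply/seteqP; split => z; rewrite /xsection/= inE/= in_itv/= /sqnorm/=.
      move=> h; have h' : z ^+ 2 < t - y ^+ 2 by rewrite ltrBrDl.
      by rewrite -ltr_norml -sqrtr_sqr ltr_sqrt// (le_lt_trans _ h')// sqr_ge0.
    rewrite -ltr_norml => h.
    have p : 0 < Num.sqrt (t - y ^+ 2) by rewrite (le_lt_trans _ h).
    move: (p); rewrite sqrtr_gt0 => p'.
    move: h; rewrite -sqrtr_sqr ltr_sqrt// ltrBrDl //.
  rewrite lebesgue_measure_itv/= lte_fin.
  case: ifPn => h; first by rewrite -EFinB; congr EFin; ring.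
  have /eqP -> : Num.sqrt (t - y ^+ 2) == 0.
    rewrite -leNgt in h; rewrite eq_le sqrtr_ge0 andbT.
    by have := le_trans h (_ : - Num.sqrt (t - y ^+ 2) <= 0); rewrite oppr_le0 sqrtr_ge0; exact.
  by rewrite mulr0.
have [t0|t0] := ltP 0 t; last first.
  rewrite mulr0; apply: integral0_eq => y _.
  by rewrite ler0_sqrtr ?mulr0// subr_le0 (le_trans t0)// sqr_ge0.
rewrite -integral_semicircle// [RHS]integral_mkcond; apply: eq_integral => y _.
rewrite patchE; case: ifPn => // ; rewrite notin_setE/= in_itv/= => h.
rewrite ler0_sqrtr ?mulr0// subr_le0.
rewrite leNgt; apply/negP => yt; apply: h.
by rewrite -ler_norml -sqrtr_sqr ler_sqrt ltW.
Qed.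

End disk.

Section radial.
Context (R : realType).
Local Notation leb := (@lebesgue_measure R).

Local Notation mR := (measurableTypeR R).
Local Notation radial_law := (measure_function_pushforward__canonical__measure_function_Measure
  (@lebesgue2 R : measure (mR * mR)%type R) (@measurable_sqnorm R)).

Let pi_nng : {nonneg R} := NngNum (pi_ge0 R).

Let mpos : measurable (`[0%R, +oo[%classic : set (measurableTypeR R)).
Proof. exact: measurable_itv. Qed.

(** Uniqueness of measures: open left rays are stable under intersection and generate the Borel
    sets, both sides agree on them by [disk_area], and the rays up to [k%:R] exhaust the line with
    finite measure. *)
Let radial_measure (A : set (measurableTypeR R)) : measurable A ->
  radial_law A = mscale pi_nng (mrestr leb mpos) A.
Proof.
apply: (@measure_unique _ R (measurableTypeR R) (@RGenInftyO.G R)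
   (fun k => `]-oo, k%:R[%classic) _ _ _ _ radial_law (mscale pi_nng (mrestr leb mpos))).
- exact: (@RGenInftyO.measurableE R).
- move=> _ _ [x ->] [y ->]; exists (Num.min x y).
  by apply/seteqP; split => z /=; rewrite !in_itv/= lt_min => /andP.
- by move=> i; exists i%:R.
- apply/seteqP; split => // z _; exists (Num.truncn `|z|).+1 => //=.
  by rewrite in_itv/= (le_lt_trans (ler_norm _))// truncnS_gt.
- move=> _ [x ->]; rewrite /= /pushforward /mscale/= /mrestr.
  have -> : @sqnorm R @^-1` `]-oo, x[ = [set y | sqnorm y < x].
    by apply/seteqP; split => z /=; rewrite in_itv.
  rewrite disk_area EFinM; congr (_ * _)%E.
  have -> : `]-oo, x[ `&` `[0, +oo[ = `[0, x[%classic :> set R.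
    by apply/seteqP; split => z /=; rewrite !in_itv/= andbT; [move=> [-> ->]|case/andP].
  rewrite lebesgue_measure_itv/= lte_fin; case: ltP => h.
    by rewrite EFinN sube0.
  by [].
- move=> k; rewrite /= /pushforward.
  have -> : @sqnorm R @^-1` `]-oo, k%:R[ = [set y | sqnorm y < k%:R].
    by apply/seteqP; split => z /=; rewrite in_itv.
  by rewrite disk_area ltry.
Qed.

Lemma integral_radial (h : R -> \bar R) : measurable_fun setT h ->
  (forall x, (0 <= h x)%E) ->
  (\int[@lebesgue2 R]_y h (sqnorm y) = pi%:E * \int[leb]_(w in `[0%R, +oo[) h w)%E.
Proof.
move=> mh h0.
have := @ge0_integral_pushforward _ _ (mR * mR)%type mR R (@sqnorm R)
  (@measurable_sqnorm R) (@lebesgue2 R) `[0%R, +oo[%classic h mpos (measurable_funTS mh) (fun x _ => h0 x).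
have -> : @sqnorm R @^-1` `[0, +oo[ = setT.
  by apply/seteqP; split => // y _ /=; rewrite in_itv/= sqnorm_ge0.
move=> <-.
rewrite (@eq_measure_integral _ _ _ _ (mscale pi_nng leb)).
  by rewrite ge0_integral_mscale//; exact: measurable_funTS.
  exact: measurable_sqnorm.
move=> Hm A mA AD; transitivity (radial_law A) => //.
rewrite (radial_measure mA) /mscale/= /mrestr.
by rewrite (setIidl AD).
Qed.

End radial.

(** * Euler's integral *)

Section mark_integral.
Context (R : realType).
Local Notation leb := (@lebesgue_measure R).

(** One minus the Laplace transform [1 / (1 + a)] of an Exp(1) mark. *)
Lemma integral_exp_mark (a : R) : 0 <= a ->
  (\int[leb]_(v in `[0%R, +oo[) ((1 - expR (- (a * v))) * expR (- v))%:E
   = (a / (1 + a))%:E)%E.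
Proof.
move=> a0; have a1 : 1 + a != 0 by rewrite gt_eqF// ltr_pwDl.
pose F (v : R) := (1 + a)^-1 * expR (- (1 + a) * v) - expR ((-1) * v).
have dF x : is_derive x (1 : R) F ((1 - expR (- (a * x))) * expR (- x)).
  apply: (is_derive1_eq (is_derive1B (is_derive1Z (1 + a)^-1
    (is_derive1_expRZ (- (1 + a)) x)) (is_derive1_expRZ (-1) x))).
  rewrite mulrA mulrN mulVf// !mulN1r mulrBl mul1r -expRD opprK addrC.
  by congr (_ - expR _); ring.
have cF x : {for x, continuous F}.
  by apply/differentiable_continuous/derivable1_diffP; have [] := dF x.
rewrite (@ge0_continuous_FTC2y R _ F 0 0).
- rewrite /F !mulr0 expR0 mulr1 -EFinB; congr EFin.
  by field.
- move=> x x0; rewrite mulr_ge0 ?expR_ge0// subr_ge0 -expR0 ler_expR oppr_le0.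
  exact: mulr_ge0.
- apply: continuous_subspaceT => x.
  apply: cvgM; last first.
    apply: continuous_cvg; first exact: continuous_expR.
    exact: continuousN.
  apply: cvgB; first exact: cvg_cst.
  apply: continuous_cvg; first exact: continuous_expR.
  apply: cvgN; apply: cvgM; first exact: cvg_cst.
  exact: cvg_id.
- have e0 (c : R) : 0 < c -> expR (- c * x) @[x --> +oo%R] --> (0 : R).
    move=> c0; under eq_fun do rewrite mulNr.
    apply: (cvg_comp (fun x => c * x) (fun y => expR (- y))); last exact: cvgr_expR.
    by apply: gt0_cvgMry => //; exact: cvg_id.
  rewrite -[X in _ --> X](subr0 0); apply: cvgB.
    rewrite -[X in _ --> X](mulr0 (1 + a)^-1); apply: cvgM; first exact: cvg_cst.
    by apply: e0; rewrite ltr_pwDl.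
  exact: e0.
- by move=> x _; have [] := dF x.
- apply: cvg_at_right_filter; exact: cF.
- by move=> x _; rewrite derive1E; have [_ ->] := dF x.
Qed.

End mark_integral.

Section radial_substitution.
Context (R : realType).
Local Notation leb := (@lebesgue_measure R).

(** Substitution and the fundamental theorem are applied on compact intervals, away from the
    singularity of [s^(-de)] at zero. The index [n.+2] keeps the left endpoint strictly below
    one. *)
Lemma integral_itv0c_lim (h : R -> R) : (forall s, 0 < s -> s <= 1 -> 0 <= h s) ->
  (forall s, 0 < s -> {for s, continuous h}) ->
  (\int[leb]_(s in `[(n.+2%:R^-1)%R, 1%R]) (h s)%:E @[n --> \oo] -->
  \int[leb]_(s in `[0%R, 1%R]) (h s)%:E)%E.
Proof.
move=> h0 ch.
have mh : measurable_fun (`]0, 1] : set R) h.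
  have mhy : measurable_fun (`]0, +oo[ : set R) h.
    apply: open_continuous_measurable_fun; first exact: interval_open.
    by move=> s; rewrite inE/= in_itv/= andbT => s0; exact: ch.
  by apply: measurable_funS mhy => //; apply: subset_itvl; rewrite bnd_simp.
have -> : (\int[leb]_(s in `[0%R, 1%R]) (h s)%:E =
   \int[leb]_(s in \bigcup_n `[(n.+2%:R^-1)%R, 1%R]%classic) (h s)%:E)%E.
  rewrite -integral_itv_obnd_cbnd; last exact/measurable_EFinP.
  congr (integral _ _ _); apply/seteqP; split => [s /=|s [n _]/=]; rewrite !in_itv/=.
    move=> /andP[s0 s1]; exists (Num.truncn s^-1) => //=; rewrite in_itv/= s1 andbT.
    rewrite -[leRHS]invrK lef_pV2 ?posrE ?invr_gt0//.
    by rewrite (le_trans (ltW (truncnS_gt _)))// ler_nat.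
  by move=> /andP[h1 ->]; rewrite andbT (lt_le_trans _ h1)// invr_gt0.
apply: ge0_nondecreasing_set_cvg_integral.
- move=> n m nm; rewrite subsetEset; apply: subset_itvr.
  by rewrite bnd_simp lef_pV2 ?posrE// ler_nat.
- by move=> n; exact: measurable_itv.
- move=> n; apply/measurable_EFinP; apply: measurable_funS mh => //.
  by apply: subset_itvr; rewrite bnd_simp invr_gt0.
- move=> n s /=; rewrite in_itv/= => /andP[s0 s1]; rewrite lee_fin h0//.
  by rewrite (lt_le_trans _ s0)// invr_gt0.
Qed.

Lemma continuous_powR (a s : R) : 0 < s -> {for s, continuous (fun x : R => x `^ a)}.
Proof.
move=> s0; apply/differentiable_continuous/derivable1_diffP.
by apply: derivable_powR; rewrite in_itv/= s0.
Qed.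

Lemma integral_powR01 (de : R) : 0 < de -> de < 1 ->
  (\int[leb]_(s in `[0%R, 1%R]) (s `^ (- de))%:E = ((1 - de)^-1)%:E)%E.
Proof.
move=> de0 de1; have d1 : 1 - de != 0 by rewrite gt_eqF// subr_gt0.
have c1 := @integral_itv0c_lim (fun s => s `^ (- de)) (fun s _ _ => powR_ge0 _ _)
  (fun s s0 => continuous_powR s0).
apply: (cvg_unique _ c1) => //=.
pose F (s : R) := (1 - de)^-1 * s `^ (1 - de).
have dF (s : R) : 0 < s -> is_derive s (1 : R) F (s `^ (- de)).
  move=> s0; apply: (is_derive1_eq (is_derive1Z (1 - de)^-1 (is_derive1_powR (1 - de) s0))).
  by rewrite mulrA mulVf// mul1r addrAC subrr sub0r.
have cF s : 0 < s -> {for s, continuous F}.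
  by move=> s0; apply/differentiable_continuous/derivable1_diffP; have [] := dF s s0.
have n2 n : 0 < n.+2%:R^-1 :> R by rewrite invr_gt0.
have E n : (\int[leb]_(s in `[(n.+2%:R^-1)%R, 1%R]) (s `^ (- de))%:E =
    (F 1 - F (n.+2%:R^-1))%:E)%E.
  have lt1 : n.+2%:R^-1 < 1 :> R by rewrite invf_lt1// ltr1n.
  rewrite (@continuous_FTC2 _ _ F _ _ lt1) ?EFinB//.
  - apply: continuous_in_subspaceT => s; rewrite inE/= in_itv/= => /andP[h _].
    by apply: continuous_powR; exact: lt_le_trans h.
  - split.
    + move=> s; rewrite in_itv/= => /andP[h _].
      by have [] := dF s (lt_trans (n2 n) h).
    + by apply: cvg_at_right_filter; exact: cF.
    + by apply: cvg_at_left_filter; exact: cF.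
  - move=> s; rewrite in_itv/= => /andP[h _]; rewrite derive1E.
    by have [_ ->] := dF s (lt_trans (n2 n) h).
under eq_fun do rewrite E.
apply: cvg_EFin; first exact: nearW.
rewrite -[X in _ --> X]subr0; apply: cvgB.
  by rewrite /F powR1 mulr1; exact: cvg_cst.
rewrite -[X in _ --> X](mulr0 (1 - de)^-1); apply: cvgM; first exact: cvg_cst.
have d0 : 0 < 1 - de by rewrite subr_gt0.
have /cvg_at_rightP := @powR_cvg0 R (1 - de) d0; apply; split => //.
by have := @cvg_harmonic R; rewrite -cvg_shiftS.
Qed.

Lemma near_pos_continuous (f g : R -> R) (x : R) : 0 < x ->
  (forall s, 0 < s -> f s = g s) -> {for x, continuous g} -> {for x, continuous f}.
Proof.
move=> x0 fg cg; rewrite /prop_for /continuous_at fg//.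
apply: cvg_trans cg; apply: near_eq_cvg; near=> s; apply/esym/fg.
by near: s; exact: lt_nbhsr.
Unshelve. all: by end_near. Qed.

Lemma measurable_inv1D (D : set R) (f : R -> R) (t : R) : measurable D ->
  measurable_fun D f -> 0 <= t -> (forall s, D s -> 0 <= f s) ->
  measurable_fun D (fun s => (1 + t * f s)^-1).
Proof.
move=> mD mf t0 f0.
have mp : measurable_fun D (fun s => (1 + t * f s) `^ (-1)).
  apply: (@measurableT_comp _ _ _ _ _ _ (fun x : R => x `^ (-1))).
    exact: measurable_powR.
  by apply: measurable_funD => //; apply: measurable_funM.
apply: eq_measurable_fun mp => s; rewrite inE => Ds.
by rewrite powR_inv1// addr_ge0// mulr_ge0// f0.
Qed.

(** The value in [integral_exp_mark] at [a = t * x], where [x] stands for a relative path loss and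
    [t] for the gain. *)
Definition saturation (t x : R) : R := t * x / (1 + t * x).

Lemma continuous_saturation (t x : R) : 0 <= t -> 0 <= x ->
  {for x, continuous (saturation t)}.
Proof.
move=> t0 x0; have c : {for x, continuous (fun z : R => t * z)}.
  by apply: cvgM; [exact: cvg_cst|exact: cvg_id].
apply: cvgM => //; apply: cvgV; last by apply: cvgD => //; exact: cvg_cst.
by rewrite gt_eqF// ltr_pwDl// mulr_ge0.
Qed.

Lemma saturation_ge0 (t x : R) : 0 <= t -> 0 <= x -> 0 <= saturation t x.
Proof. by move=> t0 x0; rewrite divr_ge0 ?addr_ge0 ?mulr_ge0. Qed.

(* The substitution [w = rho s^-de] maps [0 < s <= 1] onto [rho <= w]. *)
Lemma integral_saturation (rho t de : R) : 0 < rho -> 0 <= t -> 0 < de ->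
  (\int[leb]_(w in `[rho, +oo[) (saturation t ((w / rho) `^ (- de^-1)))%:E
   = \int[leb]_(s in `[0%R, 1%R]) (rho * de * t * (s `^ (- de) / (1 + t * s)))%:E)%E.
Proof.
move=> rho0 t0 de0.
pose F (s : R) := rho * s `^ (- de).
pose F' (s : R) := rho * (- de * s `^ (- de - 1)).
pose q (w : R) := saturation t ((w / rho) `^ (- de^-1)).
pose h (s : R) := rho * de * t * (s `^ (- de) / (1 + t * s)).
have dF (s : R) : 0 < s -> is_derive s (1 : R) F (F' s).
  by move=> s0; exact: (is_derive1Z rho (is_derive1_powR (- de) s0)).
have F'E s : 0 < s -> F^`()%classic s = F' s.
  by move=> s0; rewrite derive1E; have [_ ->] := dF s s0.
have cF s : 0 < s -> {for s, continuous F}.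
  by move=> s0; apply/differentiable_continuous/derivable1_diffP; have [] := dF s s0.
have cF' s : 0 < s -> {for s, continuous F^`()%classic}.
  move=> s0; apply: (near_pos_continuous s0 F'E).
  apply: cvgM; first exact: cvg_cst.
  by apply: cvgM; [exact: cvg_cst|exact: continuous_powR].
have cq w : 0 < w -> {for w, continuous q}.
  move=> w0; have wr : 0 < w / rho by rewrite divr_gt0.
  apply: (@continuous_cvg _ _ _ _ _ _ (saturation t)).
    by apply: continuous_saturation => //; exact: powR_ge0.
  apply: (@continuous_cvg _ _ _ _ _ _ (fun x => x `^ (- de^-1))).
    exact: continuous_powR.
  by apply: cvgM; [exact: cvg_id|exact: cvg_cst].
have ch s : 0 < s -> {for s, continuous h}.
  move=> s0; apply: cvgM; first exact: cvg_cst.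
  apply: cvgM; first exact: continuous_powR.
  apply: cvgV; first by rewrite gt_eqF// ltr_pwDl// mulr_ge0// ltW.
  by apply: cvgD; [exact: cvg_cst|apply: cvgM; [exact: cvg_cst|exact: cvg_id]].
have h0 s : 0 < s -> s <= 1 -> 0 <= h s.
  move=> s0 _; apply: mulr_ge0; first by rewrite !mulr_ge0 ?(ltW rho0) ?(ltW de0).
  by rewrite divr_ge0 ?powR_ge0// addr_ge0// mulr_ge0// ltW.
have n2 n : 0 < n.+2%:R^-1 :> R by rewrite invr_gt0.
have F1 : F 1 = rho by rewrite /F powR1 mulr1.
have Fn n : F n.+2%:R^-1 = rho * n.+2%:R `^ de.
  by rewrite /F -[_^-1]powR_inv1// -powRrM mulN1r opprK.
have E n : (\int[leb]_(w in `[rho, (rho * n.+2%:R `^ de)%R]) (q w)%:E =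
   \int[leb]_(s in `[(n.+2%:R^-1)%R, 1%R]) (h s)%:E)%E.
  have lt1 : n.+2%:R^-1 <= 1 :> R by rewrite invf_le1// ler1n.
  have := @integration_by_substitution_decreasing R F q n.+2%:R^-1 1 lt1.
  rewrite F1 Fn => ->.
  - apply: eq_integral => s; rewrite inE/= in_itv/= => /andP[sn s1].
    have s0 : 0 < s by exact: lt_le_trans sn.
    have de1 : (- de) * (- de^-1) = 1 by rewrite mulrNN divff// gt_eqF.
    have qF : q (F s) = saturation t s.
      by rewrite /q /F [rho * _]mulrC mulfK ?gt_eqF// -powRrM de1 powRr1 ?ltW.
    have -> : ((q \o F) * - F^`()%classic) s = saturation t s * - F' s.
      by rewrite -qF -F'E.
    rewrite /F' /saturation /h powRB; last by rewrite (gt_eqF s0) implybT.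
    rewrite powRr1 ?(ltW s0)//; congr EFin; field.
    by rewrite !gt_eqF// ltr_pwDl// mulr_ge0// ltW.
  - move=> x y; rewrite !in_itv/= => /andP[xn _] /andP[yn _] xy.
    have x0 : 0 < x by exact: lt_le_trans xn.
    have y0 : 0 < y by exact: lt_le_trans yn.
    rewrite /F ltr_pM2l// !powRN ltf_pV2 ?posrE ?powR_gt0//.
    by apply: gt0_ltr_powR; rewrite ?nnegrE ?ltW.
  - move=> s; rewrite in_itv/= => /andP[sn _].
    by apply: cF'; exact: lt_trans sn.
  - apply/cvg_ex; exists (F^`()%classic n.+2%:R^-1).
    by apply: cvg_at_right_filter; exact: cF'.
  - apply/cvg_ex; exists (F^`()%classic 1).
    by apply: cvg_at_left_filter; exact: cF'.
  - split.
    + move=> s; rewrite in_itv/= => /andP[sn _].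
      by have [] := dF s (lt_trans (n2 n) sn).
    + by apply: cvg_at_right_filter; exact: cF.
    + by apply: cvg_at_left_filter; exact: cF.
  - apply: continuous_in_subspaceT => w; rewrite inE/= in_itv/= => /andP[wr _].
    by apply: cq; exact: lt_le_trans wr.
have c1 := integral_itv0c_lim h0 ch.
apply: (cvg_unique _ _ c1) => //=.
have -> : `[rho, +oo[%classic = \bigcup_n `[rho, rho * n.+2%:R `^ de]%classic :> set R.
  apply/seteqP; split => [w /=|w [n _]/=]; rewrite !in_itv/= ?andbT; last by case/andP.
  move=> rw; exists (Num.truncn ((w / rho) `^ de^-1)) => //=.
  rewrite in_itv/= rw/= mulrC -ler_pdivrMr//.
  have wr : 0 <= w / rho by rewrite divr_ge0 ?(ltW rho0)// (le_trans (ltW rho0)).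
  rewrite [leLHS](_ : _ = ((w / rho) `^ de^-1) `^ de); last first.
    by rewrite -powRrM mulVf ?lt0r_neq0// powRr1.
  apply: ge0_ler_powR; rewrite ?nnegrE ?powR_ge0 ?(ltW de0)//.
  by rewrite (le_trans (ltW (truncnS_gt _)))// ler_nat.
under eq_fun do rewrite -E.
apply: ge0_nondecreasing_set_cvg_integral.
- move=> n m nm; rewrite subsetEset; apply: subset_itvl; rewrite bnd_simp.
  rewrite ler_pM2l// ge0_ler_powR ?nnegrE ?(ltW de0)// ler_nat.
  by rewrite !ltnS.
- by move=> n; exact: measurable_itv.
- move=> n; apply/measurable_EFinP.
  have mqy : measurable_fun (`]0, +oo[ : set R) q.
    apply: open_continuous_measurable_fun; first exact: interval_open.
    by move=> w; rewrite inE/= in_itv/= andbT => w0; exact: cq.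
  apply: measurable_funS mqy => //.
  move=> w /=; rewrite !in_itv/= andbT => /andP[rw _].
  exact: lt_le_trans rw.
- move=> n w _; rewrite lee_fin; apply: saturation_ge0 => //; exact: powR_ge0.
Qed.

(** With parameters [1], [1 - de], [2 - de] the exponent of [1 - s] in Euler's integral is zero, and
    the normalizing integral is [1 / (1 - de)], whence the division on the right. *)
Lemma hyp2F1_integral (de t : R) : 0 < de -> de < 1 -> 0 <= t ->
  (\int[leb]_(s in `[0%R, 1%R]) (s `^ (- de) / (1 + t * s))%:E
   = (hyp2F1 1 (1 - de) (2 - de) (- t) / (1 - de))%:E)%E.
Proof.
move=> de0 de1 t0.
have d1 : 1 - de != 0 by rewrite gt_eqF// subr_gt0.
have bnd s : s \in `[0%R, 1%R]%classic -> 0 <= s `^ (- de) / (1 + t * s) <= s `^ (- de).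
  rewrite inE/= in_itv/= => /andP[s0 _].
  have ts : 0 <= t * s by rewrite mulr_ge0.
  rewrite divr_ge0 ?powR_ge0 ?addr_ge0//= ler_pdivrMr ?ltr_pwDl//.
  by rewrite ler_peMr ?powR_ge0// lerDl.
have ml : measurable_fun (`[0%R, 1%R]%classic : set R) (fun s : R => s `^ (- de)).
  by apply: measurable_funTS; exact: measurable_powR.
have mr : measurable_fun (`[0%R, 1%R]%classic : set R) (fun s : R => s `^ (- de) / (1 + t * s)).
  apply: measurable_funM => //; apply: (@measurable_inv1D _ id) => //.
  by move=> s /=; rewrite in_itv/= => /andP[].
(* [hyp2F1] is built from real-valued integrals, which would hide an infinite value; domination by
   [s^(-de)] with [de < 1] excludes it. *)
have fin : (\int[leb]_(s in `[0%R, 1%R]) (s `^ (- de) / (1 + t * s))%:E \is a fin_num)%E.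
  rewrite ge0_fin_numE; last first.
    by apply: integral_ge0 => s sI; rewrite lee_fin; have /andP[] := bnd s (mem_set sI).
  apply: (@le_lt_trans _ _ ((1 - de)^-1)%:E); last exact: ltry.
  rewrite -integral_powR01//; apply: ge0_le_integral => //.
  - by move=> s sI; rewrite lee_fin; have /andP[] := bnd s (mem_set sI).
  - exact/measurable_EFinP.
  - exact/measurable_EFinP.
  - by move=> s sI; rewrite lee_fin; have /andP[] := bnd s (mem_set sI).
rewrite /hyp2F1 -[LHS]fineK//; congr EFin.
have -> : 1 - de - 1 = - de by ring.
have -> : 2 - de - (1 - de) - 1 = 0 by ring.
have -> : \int[leb]_(s in `[0, 1]) (s `^ (- de) * (1 - s) `^ 0) = (1 - de)^-1.
  rewrite /Rintegral; under eq_integral do rewrite powRr0 mulr1.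
  by rewrite integral_powR01.
have -> : \int[leb]_(s in `[0, 1]) (s `^ (- de) * (1 - s) `^ 0 * (1 - - t * s) `^ (-1)) =
  fine (\int[leb]_(s in `[0%R, 1%R]) (s `^ (- de) / (1 + t * s))%:E)%E.
  rewrite /Rintegral; congr fine; apply: eq_integral => s.
  rewrite inE/= in_itv/= => /andP[s0 _].
  by rewrite powRr0 mulr1 mulNr opprK powR_inv1// addr_ge0// mulr_ge0.
by rewrite invrK mulfK.
Qed.

End radial_substitution.

Section interferer_exponent.
Context (R : realType).
Local Notation leb := (@lebesgue_measure R).
Local Notation leb3 := (@lebesgue2 R \x leb)%E.

(** Points of a configuration may carry any real mark, hence the truncation at zero; it agrees with
    [esum], which discards negative terms. The exclusion test sits in the function, so that sums run
    over the whole configuration. *)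
Definition shot (alpha r b : R) (p : pt R) : R :=
  if r < norm2 p.1 then b * Num.max p.2 0 * norm2 p.1 `^ (- alpha) else 0.

Lemma shot_ge0 alpha r b p : 0 <= b -> 0 <= shot alpha r b p.
Proof.
move=> b0; rewrite /shot; case: ifP => // _.
by rewrite !mulr_ge0 ?powR_ge0// le_max lexx orbT.
Qed.

Lemma measurable_norm2 : measurable_fun setT (@norm2 R).
Proof.
apply: (@measurableT_comp _ _ _ _ _ _ (@Num.sqrt R)); last exact: measurable_sqnorm.
by apply: continuous_measurable_fun; exact: sqrt_continuous.
Qed.

Lemma measurable_shot alpha r b : measurable_fun setT (shot alpha r b).
Proof.
have mn : measurable_fun setT (fun p : pt R => norm2 p.1).
  by apply: (@measurableT_comp _ _ _ _ _ _ (@norm2 R)); [exact: measurable_norm2|exact: measurable_fst].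
apply: measurable_fun_ifT.
- by apply: measurable_fun_ltr => //; exact: measurable_cst.
- apply: measurable_funM; last first.
    apply: (@measurableT_comp _ _ _ _ _ _ (fun x : R => x `^ (- alpha))) => //.
  apply: measurable_funM; first exact: measurable_cst.
  by apply: measurable_maxr; [exact: measurable_snd|exact: measurable_cst].
- exact: measurable_cst.
Qed.

Lemma integral_mark (alpha r b th : R) (y : R * R) : 0 <= b -> 0 <= th ->
  (\int[leb]_v ((1 - expR (- (th * shot alpha r b (y, v)))) * mark_density (y, v))%:E
   = (if r < norm2 y then saturation (th * b) (norm2 y `^ (- alpha)) else 0)%:E)%E.
Proof.
move=> b0 th0.
have [ry|ry] := ltP r (norm2 y); last first.
  apply: integral0_eq => v _.
  by rewrite /shot/= ltNge ry/= mulr0 oppr0 expR0 subrr mul0r.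
rewrite -integral_exp_mark; last by rewrite mulr_ge0 ?powR_ge0// mulr_ge0.
rewrite [RHS]integral_mkcond; apply: eq_integral => v _.
rewrite patchE /mark_density /shot/= ry indicE.
case: ifPn => [|_]; last by rewrite !mulr0.
rewrite inE/= in_itv/= andbT => v0.
by rewrite mulr1 max_l//; congr ((1 - expR (- _)) * _)%:E; ring.
Qed.

Lemma shot_exponent (alpha r b th : R) : 2 < alpha -> 0 < r -> 0 <= b -> 0 <= th ->
  let t := th * b * r `^ (- alpha) in let de := 2 / alpha in
  (\int[leb3]_p ((1 - expR (- (th * shot alpha r b p))) * mark_density p)%:E
   = (pi * (r ^+ 2 * (de * t * hyp2F1 1 (1 - de) (2 - de) (- t) / (1 - de))))%:E)%E.
Proof.
move=> al2 r0 b0 th0 t de.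
have al0 : 0 < alpha by apply: lt_trans al2.
have de0 : 0 < de by rewrite divr_gt0.
have de1 : de < 1 by rewrite ltr_pdivrMr// mul1r.
have t0 : 0 <= t by rewrite mulr_ge0 ?powR_ge0// mulr_ge0.
have r20 : 0 < r ^+ 2 by rewrite exprn_gt0.
(* Here [t] is the gain at the exclusion radius and [1 / de = alpha / 2], so at [w = |y|^2] the
   power is the relative path loss [(|y| / r)^(- alpha)]. *)
pose q (w : R) := saturation t ((w / r ^+ 2) `^ (- de^-1)).
pose H (w : R) := if r ^+ 2 < w then q w else 0.
have mq : measurable_fun setT q.
  have mp : measurable_fun setT (fun w : R => (w / r ^+ 2) `^ (- de^-1)).
    apply: (@measurableT_comp _ _ _ _ _ _ (fun x : R => x `^ (- de^-1))).
      exact: measurable_powR.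
    by apply: measurable_funM.
  apply: measurable_funM; first by apply: measurable_funM.
  by apply: measurable_inv1D => // w _; exact: powR_ge0.
have mH : measurable_fun setT H.
  apply: measurable_fun_ifT => //.
  by apply: measurable_fun_ltr => //; exact: measurable_cst.
have q0 w : 0 <= q w by apply: saturation_ge0 => //; exact: powR_ge0.
have H0 w : 0 <= H w by rewrite /H; case: ifP.
rewrite fubini_tonelli1; last 2 first.
- by apply: measurable_weighted; exact: measurable_shot.
- move=> p; rewrite lee_fin mulr_ge0 ?mark_density_ge0// subr_ge0 -expR0 ler_expR.
  by rewrite oppr_le0 mulr_ge0// shot_ge0.
transitivity (\int[@lebesgue2 R]_y (H (sqnorm y))%:E)%E.
  apply: eq_integral => y _; rewrite /fubini_F integral_mark//; congr EFin.
  have n0 : 0 <= norm2 y by exact: sqrtr_ge0.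
  have sE : sqnorm y = norm2 y ^+ 2 by rewrite norm2E sqr_sqrtr// sqnorm_ge0.
  rewrite /H sE ltr_pXn2r ?nnegrE ?(ltW r0)//; case: ifP => // ry.
  have y0 := lt_trans r0 ry.
  rewrite /q -expr_div_n -powR_mulrn; last by rewrite divr_ge0 ?(ltW r0).
  rewrite -powRrM (_ : 2%:R * (- de^-1) = - alpha); last first.
    by rewrite /de; field; rewrite gt_eqF.
  have ri : r^-1 `^ (- alpha) = r `^ alpha.
    by rewrite -[r^-1]powR_inv1 ?(ltW r0)// -powRrM mulN1r opprK.
  rewrite powRM ?invr_ge0 ?(ltW r0)// ri /saturation /t.
  have rr : r `^ (- alpha) * r `^ alpha = 1 by rewrite powRN mulVf// gt_eqF// powR_gt0.
  rewrite (_ : th * b * r `^ (- alpha) * (norm2 y `^ (- alpha) * r `^ alpha) = th * b * norm2 y `^ (- alpha))//.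
  by rewrite mulrACA rr mulr1.
rewrite (@integral_radial R (EFin \o H)); last 2 first.
- exact/measurable_EFinP.
- by move=> w; rewrite /= lee_fin.
have -> : (\int[leb]_(w in `[0%R, +oo[) (EFin \o H) w =
    \int[leb]_(w in `[(r ^+ 2)%R, +oo[) (q w)%:E)%E.
  rewrite -integral_itv_obnd_cbnd; last first.
    by apply/measurable_EFinP; apply: measurable_funTS.
  rewrite -[RHS]integral_itv_obnd_cbnd; last first.
    by apply/measurable_EFinP; apply: measurable_funTS.
  rewrite integral_mkcond [RHS]integral_mkcond; apply: eq_integral => w _.
  rewrite !patchE !mem_setE/= !in_itv/= !andbT /H.
  have [rw|rw] := ltP (r ^+ 2) w; first by rewrite (lt_trans r20).
  by case: ifP.
rewrite integral_saturation//.
under eq_integral do rewrite EFinM.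
rewrite ge0_integralZl//; last 3 first.
- apply/measurable_EFinP; apply: measurable_funM.
    by apply: measurable_funTS; exact: measurable_powR.
  apply: (@measurable_inv1D _ _ id) => //.
  by move=> s /=; rewrite in_itv/= => /andP[].
- move=> s /=; rewrite in_itv/= => /andP[s0 _].
  by rewrite lee_fin divr_ge0 ?powR_ge0// addr_ge0// mulr_ge0.
- by rewrite lee_fin mulr_ge0// mulr_ge0 ?(ltW r20)// ltW.
by rewrite hyp2F1_integral// -!EFinM; congr EFin; ring.
Qed.

End interferer_exponent.

(** * Averaging over the serving distance *)

(* The integral of a nonnegative function is a supremum over simple functions
   below it, so the dominating function need not be measurable. *)
Lemma le_integral_ge0r (d : measure_display) (T : measurableType d) (R : realType)
    (mu : {measure set T -> \bar R}) (D : set T) (f g : T -> \bar R) :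
  (forall x, D x -> (0 <= g x)%E) -> (forall x, D x -> (f x <= g x)%E) ->
  (\int[mu]_(x in D) f x <= \int[mu]_(x in D) g x)%E.
Proof.
move=> g0 fg; apply: (@le_trans _ _ (\int[mu]_(x in D) (f^\+ x))%E).
  rewrite integralE; apply: geeDl; rewrite oppe_le0; exact: integral_ge0.
rewrite !ge0_integralE//; apply: le_ereal_sup => _ [h /= hf <-]; exists h => //= x.
apply: le_trans (hf x) _; rewrite !patchE; case: ifPn => //; rewrite inE => Dx.
by rewrite funeposE ge_max fg// g0.
Qed.

Section erlang_law.
Context (R : realType).

(** Truncation at zero makes this the Gamma distribution function at every real argument while
    remaining continuous. *)
Definition erlang_law (M : nat) (t : R) : R := erlang M (Num.max t 0).

Lemma continuous_erlang_law M : continuous (erlang_law M.+1).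
Proof.
move=> t; apply: (@continuous_cvg _ _ _ _ _ (fun t : R => Num.max t 0) (erlang M.+1)).
  apply/differentiable_continuous/derivable1_diffP.
  by have [] := is_derive_erlang M (Num.max t 0).
by apply: (@continuous_max _ _ id (cst 0)) => z; [exact: cvg_id|exact: cvg_cst].
Qed.

Lemma gamma_cdf_law M (t : R) :
  (\int[@lebesgue_measure R]_(x in `[0%R, t]) (gamma_pdf M.+1 x)%:E
   = (erlang_law M.+1 t)%:E)%E.
Proof.
rewrite /erlang_law; have [t0|t0] := leP 0 t; first exact: gamma_cdfE.
by rewrite erlang0 set_itv_ge ?integral_set0// bnd_simp -ltNge.
Qed.

Lemma binomial_exp (c y : R) n :
  \sum_(m < n.+1) 'C(n, m)%:R * (-1) ^+ m * expR (- (m%:R * c * y)) =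
  (1 - expR (- (c * y))) ^+ n.
Proof.
rewrite exprBn; apply: eq_bigr => m _.
rewrite expr1n mulr1 -expRM_natr -[RHS]mulr_natl !mulrA; congr (_ * _ * expR _).
by rewrite mulNr [in RHS]mulrC mulrA.
Qed.

Lemma erlang_law_ge M (phi y : R) : 0 < phi -> phi ^+ M.+1 = M.+1`!%:R^-1 ->
  0 <= y -> \sum_(m < M.+2) 'C(M.+1, m)%:R * (-1) ^+ m * expR (- (m%:R * phi * y))
            <= erlang_law M.+1 y.
Proof.
by move=> phi0 phiM y0; rewrite binomial_exp /erlang_law max_l//; exact: erlang_ge.
Qed.

Lemma erlang_law_le M (y : R) : 0 <= y -> erlang_law M.+1 y <=
  \sum_(m < M.+2) 'C(M.+1, m)%:R * (-1) ^+ m * expR (- (m%:R * y)).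
Proof.
move=> y0; have := binomial_exp 1 y M.+1.
under eq_bigr do rewrite mulr1.
by move=> ->; rewrite mul1r /erlang_law max_l//; exact: erlang_le.
Qed.

End erlang_law.

Section stretched_exponential.
Context (R : realType) (K : nat).
Local Notation leb := (@lebesgue_measure R).
Variables (c e : 'I_K -> R).
Hypothesis c0 : forall j, 0 <= c j.
Hypothesis e0 : forall j, 0 < e j.

Let h (y : R) := expR (- (pi * \sum_(j < K) c j * y `^ e j)).

Lemma stretched_measurable : measurable_fun setT h.
Proof.
apply: measurableT_comp; first exact: measurable_expR.
apply: measurableT_comp; first exact: oppr_measurable.
apply: measurable_funM; first exact: measurable_cst.
apply: measurable_sum => j; apply: measurable_funM; first exact: measurable_cst.
exact: measurable_powR.
Qed.

Lemma stretched_continuous (b : R) : 0 < b -> {within `[0, b], continuous h}.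
Proof.
move=> b0; apply/continuous_within_itvP => //.
have cc (F : set_system R) (y : R) : Filter F -> 
    (forall j, x `^ e j @[x --> F] --> y `^ e j) -> h x @[x --> F] --> h y.
  move=> FF H; apply: (@continuous_cvg _ _ _ _ _ _ (@expR R)); first exact: continuous_expR.
  apply: cvgN; apply: cvgM; first exact: cvg_cst.
  apply: (cvg_sumr (f := fun j x => c j * x `^ e j)) => j.
  by apply: cvgM; [exact: cvg_cst|exact: H].
split.
- move=> y; rewrite in_itv/= => /andP[y0 _]; apply: cc => j.
  exact: continuous_powR.
- apply: cc => j; rewrite powR0 ?gt_eqF//; exact: powR_cvg0.
- apply: cc => j; apply: cvg_at_left_filter; exact: continuous_powR.
Qed.

Lemma stretched_bounds (y : R) : 0 <= h y <= 1.
Proof.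
rewrite expR_ge0/= -expR0 ler_expR oppr_le0 mulr_ge0 ?pi_ge0// sumr_ge0// => j _.
by rewrite mulr_ge0// powR_ge0.
Qed.

(** The substitution [y = x ^+ 2]; its Jacobian [2 * x] is exactly the linear factor of the density
    [fX]. *)
Lemma stretched_square (r : R) : 0 < r ->
  (\int[leb]_(y in `[0%R, (r ^+ 2)%R]) (h y)%:E =
   \int[leb]_(x in `]0%R, r]) (2 * x * h (x ^+ 2))%:E)%E.
Proof.
move=> r0.
pose F (x : R) := x ^+ 2.
have dF (x : R) : is_derive x (1 : R) F (2 * x).
  by apply: (is_derive1_eq (is_derive1X 2 (is_derive1_id x))); rewrite mulr1 expr1.
have F'E : F^`()%classic = (fun x => 2 * x).
  by apply/funext => x; rewrite derive1E; have [_ ->] := dF x.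
have cF (x : R) : {for x, continuous F} by exact: exprn_continuous.
have cF' (x : R) : {for x, continuous F^`()%classic}.
  by rewrite F'E; apply: cvgM; [exact: cvg_cst|exact: cvg_id].
have m2 : measurable_fun setT (fun x : R => 2 * x * h (x ^+ 2)).
  apply: measurable_funM; first by apply: measurable_funM.
  apply: (@measurableT_comp _ _ _ _ _ _ h); first exact: stretched_measurable.
  exact: measurable_funX.
rewrite [RHS]integral_itv_obnd_cbnd; last first.
  by apply/measurable_EFinP; exact: measurable_funTS.
have F0 : F 0 = 0 by rewrite /F expr0n.
transitivity (\int[leb]_(y in `[F 0%R, F r]) (h y)%:E)%E; first by rewrite F0.
rewrite (@integration_by_substitution_increasing R F h 0 r (ltW r0)).
- apply: eq_integral => x _; congr EFin.
  by rewrite -[LHS]/(h (F x) * F^`()%classic x) F'E mulrC.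
- move=> x y; rewrite !in_itv/= => /andP[x0 _] /andP[y0 _] xy.
  by rewrite /F ltr_pXn2r.
- by move=> x _; exact: cF'.
- by apply/cvg_ex; exists (F^`()%classic 0); apply: cvg_at_right_filter; exact: cF'.
- by apply/cvg_ex; exists (F^`()%classic r); apply: cvg_at_left_filter; exact: cF'.
- split.
  + by move=> x _; have [] := dF x.
  + by apply: cvg_at_right_filter; exact: cF.
  + by apply: cvg_at_left_filter; exact: cF.
- by rewrite F0; apply: stretched_continuous; rewrite exprn_gt0.
Qed.

Lemma stretched_integral_fin (b : R) :
  (\int[leb]_(y in `[0%R, b]) (h y)%:E \is a fin_num)%E.
Proof.
rewrite ge0_fin_numE; last first.
  by apply: integral_ge0 => y _; rewrite lee_fin; have /andP[] := stretched_bounds y.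
apply: (@le_lt_trans _ _ (\int[leb]_(y in `[0%R, b]) (cst 1%:E) y)%E).
  apply: le_integral_ge0r => y _ /=; first by rewrite lee_fin.
  by rewrite lee_fin; have /andP[] := stretched_bounds y.
rewrite integral_cst//= mul1e lebesgue_measure_itv/=.
by case: ifP => _; rewrite ?ltry// -EFinD ltry.
Qed.

Lemma stretched_linear (z b : R) : 0 < z -> 0 <= b ->
  (\int[leb]_(y in `[0%R, b]) (expR (- (z * y)))%:E = ((1 - expR (- (z * b))) / z)%:E)%E.
Proof.
move=> z0; rewrite le_eqVlt => /predU1P[<-|b0].
  by rewrite set_itv1 integral_set1 mulr0 oppr0 expR0 subrr mul0r.
pose F (y : R) := (- z^-1) * expR (- z * y).
have dF (x : R) : is_derive x (1 : R) F (expR (- (z * x))).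
  apply: (is_derive1_eq (is_derive1Z (- z^-1) (is_derive1_expRZ (- z) x))).
  by rewrite mulrA mulrNN mulVf ?gt_eqF// mul1r mulNr.
have cF (x : R) : {for x, continuous F}.
  by apply/differentiable_continuous/derivable1_diffP; have [] := dF x.
rewrite (@continuous_FTC2 _ _ F _ _ b0).
- by rewrite -EFinB /F mulr0 expR0 [- z * b]mulNr; congr EFin; field; rewrite gt_eqF.
- apply: continuous_subspaceT => x.
  apply: continuous_cvg; first exact: continuous_expR.
  by apply: cvgN; apply: cvgM; [exact: cvg_cst|exact: cvg_id].
- split.
  + by move=> x _; have [] := dF x.
  + by apply: cvg_at_right_filter; exact: cF.
  + by apply: cvg_at_left_filter; exact: cF.
- by move=> x _; rewrite derive1E; have [_ ->] := dF x.
Qed.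

End stretched_exponential.

(** * The network *)

Section network.
Context (R : realType) (K : nat).
Variables (lam Pw B alpha : 'I_K -> R) (M : 'I_K -> nat) (lam_u eps beta : R).
Variable k : 'I_K.
Hypothesis lam_gt0 : forall j, 0 < lam j.
Hypothesis Pw_gt0 : forall j, 0 < Pw j.
Hypothesis B_gt0 : forall j, 0 < B j.
Hypothesis alpha_gt2 : forall j, 2 < alpha j.
Hypothesis M_gt0 : forall j, (0 < M j)%N.
Hypothesis lam_u_gt0 : 0 < lam_u.
Hypothesis eps_gt0 : 0 < eps.
Hypothesis beta_gt0 : 0 < beta.
Local Notation leb := (@lebesgue_measure R).
Local Notation Om := (Omega Pw B M).
Local Notation de := (delta alpha).
Local Notation Rk := (Rk Pw B alpha M eps).
Local Notation A := (Aact lam Pw B alpha M lam_u eps).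
Local Notation T := (Tassoc lam Pw B alpha M eps).
Local Notation fX := (fX lam Pw B alpha M eps).
Local Notation vphi := (varphi B alpha M).

Let alpha_gt0 j : 0 < alpha j.
Proof. exact: lt_trans (alpha_gt2 j). Qed.

Let MR_gt0 j : 0 < (M j)%:R :> R.
Proof. by rewrite ltr0n. Qed.

Let Om_gt0 j : 0 < Om j.
Proof. by rewrite !mulr_gt0. Qed.

Let OmOm_gt0 j i : 0 < Om j / Om i.
Proof. by rewrite divr_gt0. Qed.

Let de_gt0 j : 0 < de j.
Proof. by rewrite divr_gt0. Qed.

Let de_lt1 j : de j < 1.
Proof. by rewrite ltr_pdivrMr// mul1r. Qed.

Let Rk_gt0 j : 0 < Rk j.
Proof. by apply: powR_gt0; rewrite divr_gt0. Qed.

Lemma Aact_ge0 j : 0 <= A j.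
Proof.
rewrite subr_ge0 -expR0 ler_expR oppr_le0 mulr_ge0//.
  by rewrite mulr_ge0 ?pi_ge0// ltW.
by apply: Rintegral_ge0 => r _; exact: expR_ge0.
Qed.

Lemma Tassoc_ge0 j : 0 <= T j.
Proof.
rewrite mulr_ge0//; first by rewrite mulr_ge0 ?pi_ge0// ltW.
by apply: Rintegral_ge0 => r _; exact: expR_ge0.
Qed.

Lemma varphi_ge0 j b : 0 <= b -> 0 <= vphi j k b.
Proof.
move=> b0; set t := b / ((M j)%:R / (M k)%:R * (B j / B k)).
have t0 : 0 <= t by rewrite divr_ge0// mulr_ge0 ?divr_ge0 ?ltW.
rewrite -[vphi j k b]/(de j * t * hyp2F1 1 (1 - de j) (2 - de j) (- t) / (1 - de j)).
rewrite -mulrA; apply: mulr_ge0; first by rewrite mulr_ge0// ltW.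
rewrite -lee_fin -hyp2F1_integral//; apply: integral_ge0 => s /=.
rewrite in_itv/= => /andP[s0 _].
by rewrite lee_fin divr_ge0 ?powR_ge0// addr_ge0// mulr_ge0.
Qed.

Lemma phik_gt0 : 0 < phik R M k.
Proof. by apply: powR_gt0; rewrite ltr0n fact_gt0. Qed.

Lemma phik_expn : phik R M k ^+ M k = (M k)`!%:R^-1.
Proof.
rewrite -powR_mulrn ?(ltW phik_gt0)// /phik -powRrM divfK ?gt_eqF//.
by rewrite powR_inv1.
Qed.

(** The Laplace exponent of tier [j] given by [shot_exponent]; the two powers multiply to the
    squared exclusion radius. *)
Definition outage_exponent (b x : R) (j : 'I_K) : R :=
  A j * lam j * (pi * ((Om j / Om k) `^ de j * x `^ (2 * (de j / de k)) * vphi j k b)).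

(** * Outage at a fixed serving distance *)

Section pointwise.
Context (d : measure_display) (Omg : measurableType d) (Pr : probability Omg R).
Variables (G : Omg -> R) (Phi : 'I_K -> Omg -> set (pt R)).
Hypothesis mG : measurable_fun setT G.
Hypothesis mcnt : forall j (A : set (pt R)), measurable A ->
  measurable_fun [set: Omg] (fun w : Omg => cnt (Phi j w) A : \bar R).
Hypothesis gammaG : forall t : R, Pr [set w | G w <= t] =
  (\int[lebesgue_measure]_(x in `[0%R, t]) (gamma_pdf (M k) x)%:E)%E.
Hypothesis indep_counts : forall (n : nat) (tier : 'I_n -> 'I_K)
    (S : 'I_n -> set (pt R)) (c : 'I_n -> nat) (t : R),
  (forall i, measurable (S i)) ->
  (forall i, (mpp_intensity (A (tier i) * lam (tier i)) (S i) < +oo)%E) ->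
  (forall i i', i != i' -> tier i = tier i' -> S i `&` S i' = set0) ->
  Pr [set w | (G w <= t)%R /\ forall i, cnt (Phi (tier i) w) (S i) = (c i)%:R%:E] =
  (Pr [set w | (G w <= t)%R] *
   \prod_(i < n) (poisson_mass
     (fine (mpp_intensity (A (tier i) * lam (tier i)) (S i))) (c i))%:E)%E.

(** The factor in front of the interference after the outage inequality is divided by
    [P_k x^(-alpha_k)] to isolate [G]. *)
Let scale (x : R) : R := beta * x `^ alpha k / Pw k.
Let shots (x : R) (j : 'I_K) : pt R -> R :=
  shot (alpha j) (excl_radius Pw B alpha M k j x) (scale x * Pw j).

Let scale_gt0 x : 0 < x -> 0 < scale x.
Proof. by move=> x0; rewrite divr_gt0// mulr_gt0// powR_gt0. Qed.

Lemma esum_shots x j (S : set (pt R)) : 0 < x ->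
  ((scale x)%:E * (\esum_(p in S `&`
      [set p : pt R | (excl_radius Pw B alpha M k j x < norm2 p.1)%R])
      (Pw j * p.2 * powR (norm2 p.1) (- alpha j))%:E)
   = \esum_(p in S) (shots x j p)%:E)%E.
Proof.
move=> x0; rewrite esum_funepos -esumZl; last 2 first.
- exact/ltW/scale_gt0.
- by move=> p; rewrite le_max lexx orbT.
rewrite esum_mkcondr; apply: eq_esum => p _.
have -> : (p \in [set p : pt R | (excl_radius Pw B alpha M k j x < norm2 p.1)%R]) =
    (excl_radius Pw B alpha M k j x < norm2 p.1).
  by apply/idP/idP; rewrite inE.
rewrite /shots /shot; case: ifP => // _.
have -> v : maxe v%:E 0%E = (Num.max v 0)%:E :> \bar R by rewrite EFin_max.
rewrite -EFinM; congr EFin.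
have n0 : 0 <= norm2 p.1 `^ (- alpha j) by exact: powR_ge0.
rewrite -!mulrA; congr (_ * _).
have [p0|p0] := leP 0 p.2.
  by rewrite max_l// !mulr_ge0// ltW.
by rewrite mul0r mulr0 max_r// pmulr_rle0// mulr_le0_ge0// ltW.
Qed.

Lemma event_shots x : 0 < x ->
  [set w | ((Pw k * G w * powR x (- alpha k))%:E
            < (beta%:E * interference Pw B alpha M Phi k x w))%E] =
  [set w | ((G w)%:E < \sum_(j < K) \esum_(p in Phi j w) (shots x j p)%:E)%E].
Proof.
move=> x0; apply/seteqP.
have sc : 0 < x `^ alpha k / Pw k by rewrite divr_gt0// powR_gt0.
have E w : ((G w)%:E < \sum_(j < K) \esum_(p in Phi j w) (shots x j p)%:E)%E =
  ((Pw k * G w * powR x (- alpha k))%:E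
            < (beta%:E * interference Pw B alpha M Phi k x w))%E.
  have -> : (\sum_(j < K) \esum_(p in Phi j w) (shots x j p)%:E =
     (x `^ alpha k / Pw k)%:E * (beta%:E * interference Pw B alpha M Phi k x w))%E.
    rewrite muleA -EFinM.
    have -> : x `^ alpha k / Pw k * beta = scale x by rewrite /scale; ring.
    rewrite /interference ge0_sume_distrr; last first.
      by move=> j _; rewrite esum_funepos; apply: esum_ge0 => p _; rewrite le_max lexx orbT.
    by apply: eq_bigr => j _; rewrite esum_shots.
  have -> : (G w)%:E = ((x `^ alpha k / Pw k)%:E * (Pw k * G w * powR x (- alpha k))%:E)%E.
    rewrite -EFinM powRN; congr EFin; field.
    by rewrite !gt_eqF// powR_gt0.
  by rewrite lte_pmul2l// lte_fin.
by split => w /=; rewrite E.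
Qed.

Lemma excl_radius_gt0 x j : 0 < x -> 0 < excl_radius Pw B alpha M k j x.
Proof. by move=> x0; rewrite mulr_gt0 ?powR_gt0. Qed.

Lemma excl_radius_sqr x j : 0 < x -> excl_radius Pw B alpha M k j x ^+ 2 =
  (Om j / Om k) `^ de j * x `^ (2 * (de j / de k)).
Proof.
move=> x0; rewrite exprMn -!powR_mulrn ?powR_ge0// -!powRrM /delta.
congr (_ `^ _ * _ `^ _); first by rewrite mul1r mulrC.
by field; rewrite !gt_eqF.
Qed.

(** At the exclusion radius a tier-[j] station has the same biased received power as the serving
    one. This cancels [x] and the transmit powers from the argument of [varphi], leaving only
    antenna and bias ratios. *)
Lemma excl_radius_loss x j : 0 < x -> excl_radius Pw B alpha M k j x `^ (- alpha j) =
  Om k / Om j * x `^ (- alpha k).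
Proof.
move=> x0; rewrite powRM ?powR_ge0// -!powRrM.
have -> : 1 / alpha j * - alpha j = -1 by field; rewrite gt_eqF.
have -> : alpha k / alpha j * - alpha j = - alpha k by field; rewrite gt_eqF.
by rewrite powR_inv1 ?ltW// invf_div.
Qed.

Lemma shots_mean x th j : 0 < x -> 0 <= th ->
  ((A j * lam j)%:E * \int[@lebesgue2 R \x leb]_p
     ((1 - expR (- (th * shots x j p))) * mark_density p)%:E
   = (outage_exponent (th * beta) x j)%:E)%E.
Proof.
move=> x0 th0.
have b0 : 0 <= scale x * Pw j by rewrite mulr_ge0// ltW// scale_gt0.
rewrite /shots (shot_exponent (alpha_gt2 j) (excl_radius_gt0 j x0) b0 th0).
rewrite (excl_radius_sqr j x0) (excl_radius_loss j x0).
have -> : th * (scale x * Pw j) * (Om k / Om j * x `^ (- alpha k)) =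
    th * beta / ((M j)%:R / (M k)%:R * (B j / B k)).
  by rewrite /scale powRN /Omega; field; rewrite !gt_eqF ?powR_gt0.
by rewrite -EFinM.
Qed.

Let nk := (M k).-1.

Lemma outage_sandwich x : 0 < x ->
  ((\sum_(m < (M k).+1) 'C(M k, m)%:R * (-1) ^+ m *
      expR (- \sum_(j < K) outage_exponent (bL M k beta m) x j))%:E
   <= Pr [set w | ((Pw k * G w * powR x (- alpha k))%:E
            < (beta%:E * interference Pw B alpha M Phi k x w))%E]
   <= (\sum_(m < (M k).+1) 'C(M k, m)%:R * (-1) ^+ m *
      expR (- \sum_(j < K) outage_exponent (bU beta m) x j))%:E)%E.
Proof.
move=> x0; rewrite event_shots//.
have Mk : M k = nk.+1 by rewrite prednK.
have cdf t : Pr [set w | G w <= t] = (erlang_law (M k) t)%:E.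
  by rewrite gammaG Mk gamma_cdf_law.
have cont : continuous (@erlang_law R (M k)).
  by rewrite Mk; exact: continuous_erlang_law.
have FL y : 0 <= y -> \sum_(m < (M k).+1) 'C(M k, m)%:R * (-1) ^+ m *
    expR (- (m%:R * phik R M k * y)) <= erlang_law (M k) y.
  have := @erlang_law_ge R nk _ y phik_gt0; rewrite -Mk; apply.
  exact: phik_expn.
have FU y : 0 <= y -> erlang_law (M k) y <= \sum_(m < (M k).+1)
    'C(M k, m)%:R * (-1) ^+ m * expR (- (m%:R * y)).
  by rewrite Mk => y0; exact: erlang_law_le.
have := @laplace_sandwich R K d Omg Pr G (erlang_law (M k)) mG cdf cont Phi
  (fun j => A j * lam j) (fun j => mulr_ge0 (Aact_ge0 j) (ltW (lam_gt0 j))) mcnt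
  indep_counts (shots x).
move=> /(_ _ _ (fun j th => outage_exponent (th * beta) x j)) H.
apply: (H _ _ _ k (M k).+1 (fun m => 'C(M k, m)%:R * (-1) ^+ m)
  (fun m => m%:R * phik R M k) (fun m => m%:R)) => //.
- by move=> j p; apply: shot_ge0; rewrite mulr_ge0 ?ltW// scale_gt0.
- by move=> j; exact: measurable_shot.
- by move=> j th th0; exact: shots_mean.
- by move=> i; rewrite mulr_ge0// ltW// phik_gt0.
- exact: FU.
Qed.

End pointwise.

(** * Integrating the bounds over the serving distance *)

Section averaging.
Variable b : nat -> R.
Hypothesis b_ge0 : forall m, 0 <= b m.

Let coef m j := lam j * (Om j / Om k) `^ de j * (1 + A j * vphi j k (b m)).
Let ex j := de j / de k.
Let h m (y : R) := expR (- (pi * \sum_(j < K) coef m j * y `^ ex j)).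

Let coef_ge0 m j : 0 <= coef m j.
Proof.
apply: mulr_ge0; first by rewrite mulr_ge0 ?powR_ge0// ltW.
by rewrite addr_ge0// mulr_ge0 ?Aact_ge0// varphi_ge0.
Qed.

Let ex_gt0 j : 0 < ex j.
Proof. by rewrite divr_gt0. Qed.

(** The exponent of [fX] supplies the [1] and the outage exponent the [A j * vphi j k (b m)] in each
    factor [1 + A j * vphi j k (b m)]. *)
Let integrand_split x : 0 < x ->
  fX k x * (\sum_(m < (M k).+1) 'C(M k, m)%:R * (-1) ^+ m *
      expR (- \sum_(j < K) outage_exponent (b m) x j)) =
  \sum_(m < (M k).+1) (pi * lam k / T k * ('C(M k, m)%:R * (-1) ^+ m)) * (2 * x * h m (x ^+ 2)).
Proof.
move=> x0; rewrite mulr_sumr; apply: eq_bigr => m _.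
have -> : h m (x ^+ 2) = expR (- (pi * \sum_(j < K) lam j * powR (Om j / Om k) (de j)
    * powR x (2 * (de j / de k)))) * expR (- \sum_(j < K) outage_exponent (b m) x j).
  rewrite -expRD -opprD /h; congr (expR (- _)).
  rewrite !mulr_sumr -big_split; apply: eq_bigr => j _ /=.
  by rewrite /outage_exponent /coef /ex -powR_mulrn ?(ltW x0)// -powRrM; ring.
by rewrite /Defs.fX; ring.
Qed.

Let Sm m x := (2 * x * h m (x ^+ 2)).

Let Sm_measurable m : measurable_fun setT (Sm m).
Proof.
apply: measurable_funM; first by apply: measurable_funM.
apply: (@measurableT_comp _ _ _ _ _ _ (h m)); first exact: stretched_measurable.
exact: measurable_funX.
Qed.

Let integral_Sm m : (\int[leb]_(x in `]0%R, Rk k]) (Sm m x)%:E =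
  \int[leb]_(y in `[0%R, (Rk k ^+ 2)%R]) (h m y)%:E)%E.
Proof. exact/esym/(@stretched_square R K (coef m) ex ex_gt0 _ (Rk_gt0 k)). Qed.

Let integral_h_fin m :
  (\int[leb]_(y in `[0%R, (Rk k ^+ 2)%R]) (h m y)%:E \is a fin_num)%E.
Proof. exact: (@stretched_integral_fin R K (coef m) ex (coef_ge0 m)). Qed.

Let Sm_integrable m : leb.-integrable `]0, Rk k] (EFin \o Sm m).
Proof.
apply/integrableP; split.
  by apply/measurable_EFinP; apply: measurable_funTS; exact: Sm_measurable.
have -> : (\int[leb]_(x in `]0%R, Rk k]) `|(EFin \o Sm m) x| =
   \int[leb]_(x in `]0%R, Rk k]) (Sm m x)%:E)%E.
  apply: eq_integral => x; rewrite inE/= in_itv/= => /andP[x0 _].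
  by rewrite /= ger0_norm// mulr_ge0 ?expR_ge0// mulr_ge0 ?ltW.
rewrite integral_Sm; have := integral_h_fin m.
by rewrite ge0_fin_numE// integral_ge0// => y _; rewrite lee_fin expR_ge0.
Qed.

(** The alternating signs rule out additivity for nonnegative functions, so linearity relies on
    integrability of each term. *)
Lemma Obound_integral :
  (\int[leb]_(x in `]0%R, Rk k]) (fX k x * (\sum_(m < (M k).+1) 'C(M k, m)%:R * (-1) ^+ m *
      expR (- \sum_(j < K) outage_exponent (b m) x j)))%:E
   = (Obound lam Pw B alpha M lam_u eps k b)%:E)%E.
Proof.
transitivity (\int[leb]_(x in `]0%R, Rk k]) (\sum_(m <- index_enum 'I_(M k).+1)
   ((pi * lam k / T k * ('C(M k, m)%:R * (-1) ^+ m))%:E * (Sm m x)%:E)))%E.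
  apply: eq_integral => x; rewrite inE/= in_itv/= => /andP[x0 _].
  by rewrite integrand_split// -sumEFin.
rewrite integral_sum//; last first.
  by move=> m; apply: integrableZl => //; exact: Sm_integrable.
rewrite /Obound mulr_sumr -sumEFin; apply: eq_bigr => m _.
rewrite integralZl//; last exact: Sm_integrable.
rewrite integral_Sm [in RHS]mulrA [in RHS]EFinM /Rintegral fineK//.
exact: integral_h_fin.
Qed.

(** Equal path-loss exponents make every [de j / de k] equal to one, so the stretched exponential is
    a plain one of rate [pi * Z]. *)
Lemma Obound_closed a : (forall j, alpha j = a) ->
  Obound lam Pw B alpha M lam_u eps k b = Oclosed lam Pw B alpha M lam_u eps a k b.
Proof.
move=> alE; rewrite /Obound /Oclosed !mulr_sumr; apply: eq_bigr => m _.
set Z := Zcoef _ _ _ _ _ _ _ _ _ _ _.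
have deE j : de j = 2 / a by rewrite /delta alE.
have ZE : Z = \sum_(j < K) coef m j.
  rewrite /Z /Zcoef mulr_suml -big_split/=; apply: eq_bigr => j _.
  rewrite /coef deE powRM ?invr_ge0 ?ltW//.
  rewrite [(Om k)^-1 `^ _](_ : _ = (Om k `^ (2 / a))^-1); last first.
    by rewrite -powR_inv1 ?ltW// -powRrM mulN1r powRN.
  by ring.
have Z0 : 0 < Z.
  rewrite ZE (bigD1 k)//=; apply: ltr_pwDl; last first.
    by apply: sumr_ge0 => i _; exact: coef_ge0.
  rewrite mulr_gt0 ?mulr_gt0 ?powR_gt0//.
  by rewrite ltr_pwDl// mulr_ge0 ?Aact_ge0// varphi_ge0.
have -> : \int[leb]_(x in `[0, Rk k ^+ 2])
    expR (- (pi * \sum_(j < K) lam j * (Om j / Om k) `^ de j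
                   * (1 + A j * vphi j k (b m)) * x `^ (de j / de k))) =
    (1 - expR (- (pi * Z * Rk k ^+ 2))) / (pi * Z).
  rewrite /Rintegral.
  have -> : (\int[leb]_(x in `[0%R, (Rk k ^+ 2)%R])
    (expR (- (pi * \sum_(j < K) lam j * (Om j / Om k) `^ de j
                   * (1 + A j * vphi j k (b m)) * x `^ (de j / de k))))%:E =
    \int[leb]_(x in `[0%R, (Rk k ^+ 2)%R]) (expR (- (pi * Z * x)))%:E)%E.
    apply: eq_integral => x; rewrite inE/= in_itv/= => /andP[x0 _].
    congr ((expR (- _))%:E); rewrite -mulrA; congr (_ * _).
    rewrite ZE mulr_suml; apply: eq_bigr => j _.
    rewrite (_ : de j / de k = 1) ?powRr1//.
    by rewrite (deE j) -(deE k) divff// gt_eqF.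
  by rewrite stretched_linear//= ?mulr_gt0 ?pi_gt0// sqr_ge0.
(* Abstracting the inverse of [T k] spares [field] the side condition that [T k] is nonzero. *)
move: (pi_gt0 R); generalize (T k)^-1 (@pi R) => iT p p0.
by field; rewrite !gt_eqF.
Qed.

End averaging.

End network.

Theorem theorem3 (R : realType) (K : nat)
  (lam Pw B alpha : 'I_K -> R) (M : 'I_K -> nat) (lam_u eps beta : R)
  (k : 'I_K)
  (d : measure_display) (Om : measurableType d) (Pr : probability Om R)
  (G : Om -> R) (Phi : 'I_K -> Om -> set (pt R)) :
  (forall j, 0 < lam j) -> (forall j, 0 < Pw j) -> (forall j, 0 < B j) ->
  (forall j, 2 < alpha j) -> (forall j, (0 < M j)%N) ->
  0 < lam_u -> 0 < eps -> 0 < beta ->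
  (* measurability of the signal gain and of the point-count variables *)
  measurable_fun setT G ->
  (forall j (A : set (pt R)), measurable A ->
     measurable_fun [set: Om] (fun w : Om => cnt (Phi j w) A : \bar R)) ->
  (* |h|^2 ~ Gamma(M_k, 1) *)
  (forall t : R, Pr [set w | G w <= t] =
     (\int[lebesgue_measure]_(x in `[0%R, t]) (gamma_pdf (M k) x)%:E)%E) ->
  (* Phi j: independent homogeneous PPPs of intensity A_j lambda_j with i.i.d.
     Exp(1) marks, all independent of |h|^2 (finite-dimensional distributions) *)
  (forall (n : nat) (tier : 'I_n -> 'I_K) (A : 'I_n -> set (pt R))
          (c : 'I_n -> nat) (t : R),
     (forall i, measurable (A i)) ->
     (forall i, (mpp_intensity (Aact lam Pw B alpha M lam_u eps (tier i) * lam (tier i))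
                   (A i) < +oo)%E) ->
     (forall i i', i != i' -> tier i = tier i' -> A i `&` A i' = set0) ->
     Pr [set w | (G w <= t)%R /\ forall i, cnt (Phi (tier i) w) (A i) = (c i)%:R%:E] =
     (Pr [set w | (G w <= t)%R] *
      \prod_(i < n) (poisson_mass
         (fine (mpp_intensity (Aact lam Pw B alpha M lam_u eps (tier i) * lam (tier i))
                  (A i))) (c i))%:E)%E) ->
  let O := Oint lam Pw B alpha M eps Pr G Phi k beta in
  let OL := Obound lam Pw B alpha M lam_u eps k (bL M k beta) in
  let OU := Obound lam Pw B alpha M lam_u eps k (bU beta) in
  [/\ OL <= O, O <= OU &
   forall a : R, (forall j, alpha j = a) ->
     OL = Oclosed lam Pw B alpha M lam_u eps a k (bL M k beta) /\
     OU = Oclosed lam Pw B alpha M lam_u eps a k (bU beta)].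
Proof.
move=> lam0 Pw0 B0 al2 M0 lu0 eps0 beta0 mG mcnt gammaG indep O OL OU.
have bL0 m : 0 <= bL M k beta m.
  by rewrite !mulr_ge0 ?(ltW beta0)// ltW// phik_gt0.
have bU0 m : 0 <= bU beta m by rewrite mulr_ge0// ltW.
have IL := Obound_integral k lam0 Pw0 B0 al2 M0 lu0 eps0 bL0.
have IU := Obound_integral k lam0 Pw0 B0 al2 M0 lu0 eps0 bU0.
rewrite -/OL in IL; rewrite -/OU in IU.
have fX0 x : 0 < x -> 0 <= fX lam Pw B alpha M eps k x.
  move=> x0; rewrite mulr_ge0 ?expR_ge0// mulr_ge0 ?(ltW x0)// divr_ge0 ?Tassoc_ge0//.
  by rewrite !mulr_ge0 ?pi_ge0// ltW.
pose E x := [set w | ((Pw k * G w * powR x (- alpha k))%:E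
               < (beta%:E * interference Pw B alpha M Phi k x w))%E].
have SW x : 0 < x -> _ := fun x0 =>
  outage_sandwich lam0 Pw0 B0 al2 M0 lu0 beta0 mG mcnt gammaG indep x0.
pose I := (\int[@lebesgue_measure R]_(x in `]0%R, Rk Pw B alpha M eps k])
   (fX lam Pw B alpha M eps k x * fine (Pr (E x)))%:E)%E.
have fin x : 0 < x -> Pr (E x) \is a fin_num.
  move=> /SW/andP[l u]; apply: fin_real.
  by rewrite (lt_le_trans (ltNyr _) l) (le_lt_trans u (ltry _)).
have I0 : (0 <= I)%E.
  apply: integral_ge0 => x /=; rewrite in_itv/= => /andP[x0 _].
  by rewrite lee_fin mulr_ge0 ?fX0// fine_ge0.
(* The alternating lower bound may be negative at some [x]; the comparison asks nonnegativity only
   of the dominating function, here density times probability. *)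
have LI : (OL%:E <= I)%E.
  rewrite -IL; apply: le_integral_ge0r => x /=; rewrite in_itv/= => /andP[x0 _].
    by rewrite lee_fin mulr_ge0 ?fX0// fine_ge0.
  rewrite lee_fin ler_wpM2l ?fX0// -lee_fin fineK ?fin//.
  by have /andP[] := SW x x0.
have UI : (I <= OU%:E)%E.
  rewrite -IU; apply: le_integral_ge0r => x /=; rewrite in_itv/= => /andP[x0 _].
    rewrite lee_fin mulr_ge0 ?fX0// -lee_fin.
    by have /andP[_] := SW x x0; apply: le_trans.
  rewrite lee_fin ler_wpM2l ?fX0// -lee_fin fineK ?fin//.
  by have /andP[] := SW x x0.
(* [O] is the [fine] part of [I]; the upper bound makes [I] finite, so nothing is lost in passing to
   the reals. *)
have Ifin : I \is a fin_num.
  by rewrite ge0_fin_numE// (le_lt_trans UI)// ltry.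
have OE : O%:E = I by rewrite -(fineK Ifin).
split; first by rewrite -lee_fin OE.
  by rewrite -lee_fin OE.
by move=> a alE; split; apply: Obound_closed.
Qed.
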